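(* For every integer $q>1$, \begin{align*} (1+(-1)^{q+1})\bar T_{1^2,q}&=(q-2)\pi \zeta(\overline{q+1})-2\pi \zeta(\bar q,1)-4\pi \log(2)\zeta(\bar q)-2\widetilde{t}(\overline{q+1},1)\\ &\quad+(-1)^q\bar t(q+2)-(1+(-1)^q)4\log(2)\bar t(q+1)-(1-(-1)^q) 4\log^2(2)\bar t(q)\\ &\quad-2\sum_{\substack{2k_1+k_2+k_3=q+1\\ k_1,k_2,k_3\geq 1}} \bar t(2k_1-1)\zeta(k_2+1)\zeta(k_3+1)+4\sum_{\substack{2k_1+k_2=q+2\\ k_1,k_2\geq 1}}\bar t(2k_1-1)\zeta(k_2+1)\\ &\quad+8\log(2)\sum_{\substack{2k_1+k_2=q+1\\ k_1,k_2\geq 1}}\bar t(2k_1-1)\zeta(k_2+1). \end{align*}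
   Context: Let $h_n=\sum_{k=1}^n (k-1/2)^{-1}$ for $n\ge0$. $\bar T_{1^2,q}=\sum_{n\ge1}\frac{h_{n-1}^2}{(n-1/2)^q}(-1)^n$. For $s\ge1$, $\bar t(s)=\sum_{n\ge1}\frac{(-1)^{n-1}}{(n-1/2)^s}$. Alternating values: $\zeta(\bar s)=\sum_{n\ge1}\frac{(-1)^n}{n^s}$, $\zeta(\bar s,1)=\sum_{n_1>n_2\ge1}\frac{(-1)^{n_1}}{n_1^{s}n_2}$, and $\widetilde t(\bar s,1)=\sum_{n_1>n_2\ge1}\frac{(-1)^{n_1}}{(n_1-1/2)^{s}(n_2-1/2)}$. $\zeta$ is the Riemann zeta function. *)

(* Defs.v *)
From Stdlib Require Import Reals.
From Coquelicot Require Import Coquelicot.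
Open Scope R_scope.

(* sum over n >= 1 of a n, as the limit of the partial sums *)
Definition Series1 (a : nat -> R) : R := Series (fun n => a (S n)).

(* [sum_n_m a 1 0 = 0], so the sums below are empty when their upper bound is 0. *)
Definition h (n : nat) : R := sum_n_m (fun k => / (INR k - / 2)) 1 n.

Definition Tbar (q : nat) : R :=
  Series1 (fun n => h (n - 1) ^ 2 / (INR n - / 2) ^ q * (-1) ^ n).

Definition tbar (s : nat) : R :=
  Series1 (fun n => (-1) ^ (n - 1) / (INR n - / 2) ^ s).

Definition zeta (s : nat) : R := Series1 (fun n => / INR n ^ s).

Definition zetabar (s : nat) : R := Series1 (fun n => (-1) ^ n / INR n ^ s).

(* The double sums over n1 > n2 >= 1 are summed over n2 first. *)
Definition zetabar1 (s : nat) : R :=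
  Series1 (fun n1 =>
    sum_n_m (fun n2 => (-1) ^ n1 / (INR n1 ^ s * INR n2)) 1 (n1 - 1)).

Definition ttildebar1 (s : nat) : R :=
  Series1 (fun n1 =>
    sum_n_m
      (fun n2 => (-1) ^ n1 / ((INR n1 - / 2) ^ s * (INR n2 - / 2))) 1 (n1 - 1)).

(* Sums over positive k1, k2 (, k3) with 2 k1 + k2 (+ k3) = N; the bound N on
   each index is implied by the equation. *)
Definition sum_2k1_k2 (N : nat) (F : nat -> nat -> R) : R :=
  sum_n_m (fun k1 => sum_n_m (fun k2 =>
    if Nat.eqb (2 * k1 + k2) N then F k1 k2 else 0) 1 N) 1 N.

Definition sum_2k1_k2_k3 (N : nat) (F : nat -> nat -> nat -> R) : R :=
  sum_n_m (fun k1 => sum_n_m (fun k2 => sum_n_m (fun k3 =>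
    if Nat.eqb (2 * k1 + k2 + k3) N then F k1 k2 k3 else 0) 1 N) 1 N) 1 N.

(* Main.v *)
Require Import Defs.
From Stdlib Require Import Reals Lra Lia.
From Coquelicot Require Import Coquelicot.
Open Scope R_scope.

(** Let Psi(s) = 1/s + L + sum_(k >= 1) (1/k + 1/(s - k)), which is
    psi(-s) + gamma + L for the digamma function psi.  For L = 2 log 2 it takes
    the values h_n at n - 1/2 and h_(n-1) at -(n - 1/2).  The identity is the
    vanishing of the sum of the residues of (pi / cos(pi s)) Psi(s)^2 / s^q, but
    it is reached without complex analysis: Psi(a)^2 / a^q has an explicit real
    partial fraction expansion in a, with poles at 0 and at the positive
    integers.  For q = 2 it comes from squaring the series of Psi; one passes from
    q to q + 1 by Euler's formula for sum_k H_k / k^(q+1).  Summing the expansion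
    with alternating signs over the half-integers a = +-(n - 1/2), n <= N, and
    letting N tend to infinity replaces 1/(a - k) by -(-1)^k pi and 1/(a - k)^2
    by 0, the inner alternating sums being differences of partial sums of
    [tbar 1] = pi/2 and [tbar 2]. *)

(** * Finite sums and dominated convergence of series *)

(** The obstacle is the order of summation: since 1/(a - k) decays only like 1/n at a = +-(n - 1/2),
    the double series over n and the poles k is not absolutely convergent. The sum over n therefore
    stays finite while it is exchanged with the series over k. What makes the limit legitimate is
    that the inner alternating sums are bounded uniformly in both N and k, so that Tannery's theorem
    applies to the series over k. Squaring the series of Psi and proving Euler's formula are one
    computation. In both, the off-diagonal terms of a product of two series are, up to sign, divided
    differences (phi(x) - phi(y)) / (x y (x - y)), with phi(x) = 1/(a - x) or phi(x) = x^(-m), and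
    their double sum has a limit that depends linearly on phi. The expansion holds for every
    constant L. The value 2 log 2 enters only through the normalization Psi(-1/2) = h_0 = 0. *)

Fixpoint psum (u : nat -> R) (n : nat) : R :=
  match n with O => 0 | S m => psum u m + u m end.

Lemma psum_S (u : nat -> R) (n : nat) : psum u (S n) = psum u n + u n.
Proof. reflexivity. Qed.

Lemma psum_ext_lt (u v : nat -> R) (n : nat) :
  (forall k, (k < n)%nat -> u k = v k) -> psum u n = psum v n.
Proof.
  induction n as [|n IH]; intros E; simpl; auto.
  rewrite IH, E; auto.
Qed.

Lemma psum_ext (u v : nat -> R) (n : nat) :
  (forall k, u k = v k) -> psum u n = psum v n.
Proof. intros E; apply psum_ext_lt; auto. Qed.

Lemma psum_plus (u v : nat -> R) (n : nat) :
  psum (fun k => u k + v k) n = psum u n + psum v n.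
Proof. induction n as [|n IH]; simpl; [ring | rewrite IH; ring]. Qed.

Lemma psum_minus (u v : nat -> R) (n : nat) :
  psum (fun k => u k - v k) n = psum u n - psum v n.
Proof. induction n as [|n IH]; simpl; [ring | rewrite IH; ring]. Qed.

Lemma psum_scal (c : R) (u : nat -> R) (n : nat) :
  psum (fun k => c * u k) n = c * psum u n.
Proof. induction n as [|n IH]; simpl; [ring | rewrite IH; ring]. Qed.

Lemma psum_const (c : R) (n : nat) : psum (fun _ => c) n = INR n * c.
Proof. induction n as [|n IH]; [simpl; ring | rewrite S_INR; simpl; rewrite IH; ring]. Qed.

Lemma psum_swap (F : nat -> nat -> R) (m n : nat) :
  psum (fun i => psum (F i) n) m = psum (fun j => psum (fun i => F i j) m) n.
Proof.
  induction m as [|m IH]; simpl.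
  - rewrite psum_const; ring.
  - rewrite IH, <- psum_plus. reflexivity.
Qed.

Lemma psum_mult (u v : nat -> R) (m n : nat) :
  psum u m * psum v n = psum (fun i => psum (fun j => u i * v j) n) m.
Proof.
  induction m as [|m IH]; simpl; [ring|].
  rewrite psum_scal, <- IH; ring.
Qed.

Lemma psum_S_l (u : nat -> R) (n : nat) :
  psum u (S n) = u O + psum (fun k => u (S k)) n.
Proof. induction n as [|n IH]; [simpl; ring|]. simpl in *; rewrite IH; ring. Qed.

Lemma psum_rev (u : nat -> R) (n : nat) :
  psum u n = psum (fun k => u (n - 1 - k)%nat) n.
Proof.
  induction n as [|n IH]; [reflexivity|].
  rewrite (psum_S_l (fun k => u (S n - 1 - k)%nat)).
  replace (S n - 1 - 0)%nat with n by lia.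
  simpl; rewrite IH, Rplus_comm; f_equal.
  apply psum_ext; intros k; f_equal; lia.
Qed.

Lemma sum_n_m_psum (f : nat -> R) (n : nat) :
  sum_n_m f 1 n = psum (fun k => f (S k)) n.
Proof.
  induction n as [|n IH].
  - rewrite sum_n_m_zero by lia. reflexivity.
  - rewrite sum_n_Sm by lia. rewrite IH. reflexivity.
Qed.

Lemma sum_n_psum (u : nat -> R) (n : nat) : sum_n u n = psum u (S n).
Proof.
  induction n as [|n IH]; [rewrite sum_O; simpl; ring|].
  rewrite sum_Sn, IH. reflexivity.
Qed.

Lemma is_series_psum (u : nat -> R) (l : R) :
  is_series u l <-> is_lim_seq (psum u) l.
Proof.
  split; intros E.
  - apply is_lim_seq_incr_1.
    apply is_lim_seq_ext with (2 := E). intros n; apply sum_n_psum.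
  - apply is_lim_seq_incr_1 in E.
    apply is_lim_seq_ext with (2 := E). intros n; symmetry; apply sum_n_psum.
Qed.

Lemma Series_psum_lim (u : nat -> R) :
  ex_series u -> is_lim_seq (psum u) (Series u).
Proof. intros E; apply is_series_psum, Series_correct, E. Qed.

Lemma psum_lim (f : nat -> nat -> R) (l : nat -> R) (n : nat) :
  (forall k, is_lim_seq (fun N => f N k) (l k)) ->
  is_lim_seq (fun N => psum (f N) n) (psum l n).
Proof.
  intros E; induction n as [|n IH]; simpl.
  - apply is_lim_seq_const.
  - apply is_lim_seq_plus'; auto.
Qed.

Lemma is_series_psum_Series (f : nat -> nat -> R) (n : nat) :
  (forall i, ex_series (f i)) ->
  is_series (fun k => psum (fun i => f i k) n) (psum (fun i => Series (f i)) n).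
Proof.
  intros E; apply is_series_psum.
  apply is_lim_seq_ext with (u := fun N => psum (fun i => psum (f i) N) n).
  - intros N; apply psum_swap.
  - apply psum_lim; intros k; apply Series_psum_lim, E.
Qed.

Lemma ex_series_bound (g u : nat -> R) (C : R) :
  ex_series g -> (forall k, Rabs (u k) <= C * g k) -> ex_series u.
Proof.
  intros Eg E; apply (ex_series_le (K := R_AbsRing) (V := R_CompleteNormedModule) u (fun k => C * g k)); [exact E|].
  apply (ex_series_scal (K := R_AbsRing) (V := R_NormedModule) C g Eg).
Qed.

Lemma Series_tail_le (u g : nat -> R) (K : nat) :
  ex_series g -> (forall k, Rabs (u k) <= g k) ->
  Rabs (Series u - psum u K) <= Series g - psum g K.
Proof.
  intros Eg E.
  assert (Eu : ex_series u) by (apply (ex_series_bound g u 1); auto; intros k; rewrite Rmult_1_l; apply E).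
  assert (F : forall n, Rabs (psum u (n + K) - psum u K) <= psum g (n + K) - psum g K).
  { induction n as [|n IH]; simpl.
    - rewrite !Rminus_diag. rewrite Rabs_R0; lra.
    - replace (psum u (n + K) + u (n + K)%nat - psum u K)
        with ((psum u (n + K) - psum u K) + u (n + K)%nat) by ring.
      eapply Rle_trans; [apply Rabs_triang|]. specialize (E (n + K)%nat); lra. }
  assert (L : Rbar_le (Rabs (Series u - psum u K)) (Series g - psum g K)).
  { eapply is_lim_seq_le; [exact F| |].
    - apply (is_lim_seq_abs (fun n => psum u (n + K) - psum u K) (Series u - psum u K)).
      apply is_lim_seq_minus'; [|apply is_lim_seq_const].
      apply (is_lim_seq_incr_n (psum u) K), Series_psum_lim, Eu.
    - apply is_lim_seq_minus'; [|apply is_lim_seq_const].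
      apply (is_lim_seq_incr_n (psum g) K), Series_psum_lim, Eg. }
  exact L.
Qed.

Lemma tannery (f : nat -> nat -> R) (l g : nat -> R) :
  ex_series g -> (forall N k, Rabs (f N k) <= g k) ->
  (forall k, is_lim_seq (fun N => f N k) (l k)) ->
  is_lim_seq (fun N => Series (f N)) (Series l).
Proof.
  intros Eg Ef El.
  assert (Bl : forall k, Rabs (l k) <= g k).
  { intros k.
    assert (L : Rbar_le (Rabs (l k)) (g k)); [|exact L].
    eapply is_lim_seq_le; [intros N; apply (Ef N k)| |apply is_lim_seq_const].
    apply (is_lim_seq_abs _ (l k)), El. }
  apply is_lim_seq_spec; intros eps.
  assert (e3 : 0 < eps / 3) by (destruct eps; simpl; lra).
  assert (Lg := Series_psum_lim g Eg).
  apply is_lim_seq_spec in Lg. destruct (Lg (mkposreal _ e3)) as [K HK].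
  specialize (HK K (Nat.le_refl K)); simpl in HK. rewrite Rabs_minus_sym in HK.
  assert (Lp := psum_lim f l K El).
  apply is_lim_seq_spec in Lp. destruct (Lp (mkposreal _ e3)) as [N0 HN].
  exists N0; intros N LN. specialize (HN N LN); simpl in HN.
  assert (T1 := Series_tail_le (f N) g K Eg (Ef N)).
  assert (T2 := Series_tail_le l g K Eg Bl).
  assert (T3 := Rle_abs (Series g - psum g K)).
  apply Rabs_def2 in HN. apply Rabs_le_between in T1. apply Rabs_le_between in T2.
  apply Rabs_def1; lra.
Qed.

Lemma Series_trunc (u : nat -> R) (n : nat) :
  Series (fun k => if Nat.ltb k n then u k else 0) = psum u n.
Proof.
  apply is_series_unique, is_series_psum, (is_lim_seq_incr_n _ n).
  apply is_lim_seq_ext with (u := fun _ => psum u n); [|apply is_lim_seq_const].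
  induction n0 as [|m IH]; simpl.
  - apply psum_ext_lt; intros k Hk. apply Nat.ltb_lt in Hk; rewrite Hk; reflexivity.
  - rewrite <- IH. replace (Nat.ltb (m + n) n) with false; [ring|].
    symmetry; apply Nat.ltb_ge; lia.
Qed.

(** Tannery's theorem for sums whose length grows with N: extended by zero beyond N, they become
    series, and the bound is asked only where terms occur. *)
Lemma tannery_psum (f : nat -> nat -> R) (l g : nat -> R) :
  ex_series g -> (forall N k, (k < N)%nat -> Rabs (f N k) <= g k) ->
  (forall k, is_lim_seq (fun N => f N k) (l k)) ->
  is_lim_seq (fun N => psum (f N) N) (Series l).
Proof.
  intros Eg Ef El.
  apply is_lim_seq_ext with
    (u := fun N => Series (fun k => if Nat.ltb k N then f N k else 0)).
  { intros N; apply Series_trunc. }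
  apply tannery with (g := g); auto.
  - intros N k; destruct (Nat.ltb k N) eqn:E.
    + apply Ef, Nat.ltb_lt, E.
    (* The bound at N = k + 1 shows that [g k] is nonnegative. *)
    + rewrite Rabs_R0. specialize (Ef (S k) k (Nat.lt_succ_diag_r k)).
      assert (Z := Rabs_pos (f (S k) k)); lra.
  - intros k. apply is_lim_seq_ext_loc with (2 := El k).
    exists (S k); intros N LN. replace (Nat.ltb k N) with true; auto.
    symmetry; apply Nat.ltb_lt; lia.
Qed.

Lemma ex_series_telescope (u d : nat -> R) :
  (forall k, 0 <= d k <= u k - u (S k)) -> (forall k, 0 <= u k) -> ex_series d.
Proof.
  intros E P.
  assert (B : forall n, psum d n <= u O - u n).
  { induction n as [|n IH]; simpl; [lra|]. specialize (E n); lra. }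
  destruct (ex_finite_lim_seq_incr (psum d) (u O)) as [l Hl].
  - intros n; simpl; specialize (E n); lra.
  - intros n; specialize (B n); specialize (P n); lra.
  - exists l; apply is_series_psum, Hl.
Qed.

Lemma ex_series_ext_R (u v : nat -> R) :
  (forall k, u k = v k) -> ex_series u -> ex_series v.
Proof. apply ex_series_ext. Qed.

Lemma ex_series_scal_R (c : R) (u : nat -> R) :
  ex_series u -> ex_series (fun k => c * u k).
Proof. apply (ex_series_scal (K := R_AbsRing) (V := R_NormedModule)). Qed.

Lemma is_lim_seq_scal_R (c : R) (u : nat -> R) (l : R) :
  is_lim_seq u l -> is_lim_seq (fun n => c * u n) (c * l).
Proof. apply (is_lim_seq_scal_l u c l). Qed.

Lemma is_lim_seq_unique_R (u : nat -> R) (l1 l2 : R) :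
  is_lim_seq u l1 -> is_lim_seq u l2 -> l1 = l2.
Proof.
  intros E1 E2. apply is_lim_seq_unique in E1. apply is_lim_seq_unique in E2.
  congruence.
Qed.

(** * Harmonic numbers and symmetric double sums *)

Definition harmonic (n : nat) : R := psum (fun k => / INR (S k)) n.

Lemma INR_S_ge1 (k : nat) : 1 <= INR (S k).
Proof. rewrite S_INR; assert (Z := pos_INR k); lra. Qed.

Lemma INR_S_neq0 (k : nat) : INR (S k) <> 0.
Proof. assert (Z := INR_S_ge1 k); lra. Qed.

Lemma inv_INR_S_bounds (k : nat) : 0 < / INR (S k) <= 1.
Proof.
  assert (Z := INR_S_ge1 k); split.
  - apply Rinv_0_lt_compat; lra.
  - rewrite <- Rinv_1; apply Rinv_le_contravar; lra.
Qed.

Lemma harmonic_S (n : nat) : harmonic (S n) = harmonic n + / INR (S n).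
Proof. reflexivity. Qed.

Lemma harmonic_ge0 (n : nat) : 0 <= harmonic n.
Proof.
  induction n as [|n IH]; [unfold harmonic; simpl; lra|].
  rewrite harmonic_S; assert (Z := inv_INR_S_bounds n); lra.
Qed.

Lemma harmonic_S_ge1 (n : nat) : 1 <= harmonic (S n).
Proof.
  induction n as [|n IH]; [unfold harmonic; simpl; lra|].
  rewrite harmonic_S; assert (Z := inv_INR_S_bounds (S n)); lra.
Qed.

Lemma harmonic_diff_bounds (m n : nat) :
  0 <= harmonic (m + n) - harmonic m <= INR n.
Proof.
  induction n as [|n IH].
  - rewrite Nat.add_0_r; simpl; lra.
  - rewrite Nat.add_succ_r, harmonic_S, (S_INR n).
    assert (Z := inv_INR_S_bounds (m + n)); lra.
Qed.

Lemma harmonic_le_INR (n : nat) : harmonic n <= INR n.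
Proof.
  assert (Z := harmonic_diff_bounds 0 n). change (harmonic 0) with 0 in Z.
  simpl Nat.add in Z; lra.
Qed.

Lemma is_lim_seq_inv_INR_S : is_lim_seq (fun n => / INR (S n)) 0.
Proof.
  apply (is_lim_seq_incr_1 (fun n => / INR n)).
  replace (Finite 0) with (Rbar_inv p_infty) by reflexivity.
  apply is_lim_seq_inv; [apply is_lim_seq_INR | discriminate].
Qed.

Lemma harmonic_diff_lim (n : nat) :
  is_lim_seq (fun m => harmonic (m + n) - harmonic m) 0.
Proof.
  induction n as [|n IH].
  - apply is_lim_seq_ext with (u := fun _ => 0); [|apply is_lim_seq_const].
    intros m; rewrite Nat.add_0_r; ring.
  - replace (Finite 0) with (Finite (0 + 0)) by (f_equal; ring).
    apply is_lim_seq_ext with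
      (u := fun m => (harmonic (m + n) - harmonic m) + / INR (S (m + n))).
    + intros m; rewrite Nat.add_succ_r, harmonic_S; ring.
    + apply is_lim_seq_plus'; [exact IH|].
      apply (is_lim_seq_incr_n (fun m => / INR (S m)) n), is_lim_seq_inv_INR_S.
Qed.

(* A common summable majorant, up to constants, for the absolutely convergent series below. *)
Definition hdom (k : nat) : R := harmonic (S k) / INR (S k) ^ 2.

(** The telescoping majorant is modelled on the antiderivative -(ln x + 1)/x of ln x / x^2; the
    factor 2 leaves room for passing from the integral to differences. *)
Lemma ex_series_hdom : ex_series hdom.
Proof.
  apply ex_series_telescope with (u := fun k => 2 * (harmonic (S k) + 1) / INR (S k)).
  - intros k; unfold hdom. rewrite (harmonic_S (S k)).
    assert (Z := INR_S_ge1 k). assert (HH := harmonic_S_ge1 k).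
    rewrite (S_INR (S k)). set (x := INR (S k)) in *. set (y := harmonic (S k)) in *.
    split.
    + apply Rdiv_le_0_compat; [lra | apply pow_lt; lra].
    + apply Rminus_le_0.
      replace (2 * (y + 1) / x - 2 * (y + / (x + 1) + 1) / (x + 1) - y / x ^ 2)
        with ((2 * x + y * (x * x - 1)) / (x ^ 2 * (x + 1) ^ 2)) by (field; lra).
      assert (0 <= x * x - 1) by nra. assert (0 <= y * (x * x - 1)) by (apply Rmult_le_pos; lra).
      apply Rdiv_le_0_compat; [lra|]. apply Rmult_lt_0_compat; apply pow_lt; lra.
  - intros k. assert (Z := INR_S_ge1 k). assert (HH := harmonic_S_ge1 k).
    apply Rdiv_le_0_compat; lra.
Qed.

Lemma inv_sq_le_hdom (k : nat) : / INR (S k) ^ 2 <= hdom k.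
Proof.
  unfold hdom, Rdiv. assert (Z := INR_S_ge1 k). assert (HH := harmonic_S_ge1 k).
  assert (0 < / INR (S k) ^ 2) by (apply Rinv_0_lt_compat, pow_lt; lra). nra.
Qed.

Lemma inv_pow_le (x : R) (m n : nat) : 1 <= x -> (m <= n)%nat -> 0 < / x ^ n <= / x ^ m.
Proof.
  intros Hx Hmn; split; [apply Rinv_0_lt_compat, pow_lt; lra|].
  apply Rinv_le_contravar; [apply pow_lt; lra | apply Rle_pow; auto].
Qed.

Lemma psum_diag (u : nat -> R) (k n : nat) :
  (k < n)%nat ->
  psum u n = u k + psum (fun j => if Nat.eqb k j then 0 else u j) n.
Proof.
  induction n as [|n IH]; intros Hk; [lia|]; simpl.
  destruct (Nat.eqb_spec k n) as [->|D].
  - rewrite Rplus_0_r, Rplus_comm. f_equal.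
    apply psum_ext_lt; intros j Hj. destruct (Nat.eqb_spec n j); [lia|auto].
  - rewrite IH by lia; ring.
Qed.

Lemma psum_psum_diag (F : nat -> nat -> R) (n : nat) :
  psum (fun k => psum (F k) n) n =
  psum (fun k => F k k) n
  + psum (fun k => psum (fun j => if Nat.eqb k j then 0 else F k j) n) n.
Proof.
  rewrite <- psum_plus. apply psum_ext_lt; intros k Hk. apply psum_diag, Hk.
Qed.

(** The common form of the off-diagonal part of a product of two truncated series: [pole_sq] uses it
    with phi = 1/(a - K), [zeta_conv_euler] with phi = K^(-p-1), where K = k + 1. *)
Definition divdiff_sum (phi : nat -> R) (n : nat) : R :=
  psum (fun k => psum (fun j => if Nat.eqb k j then 0 else
    (phi k - phi j) / (INR (S k) * INR (S j) * (INR (S k) - INR (S j)))) n) n.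

Lemma INR_S_diff_neq0 (k j : nat) : k <> j -> INR (S k) - INR (S j) <> 0.
Proof. intros D E. apply D. apply eq_add_S, INR_eq; lra. Qed.

Lemma psum_inv_diff (k d : nat) :
  psum (fun j => if Nat.eqb k j then 0 else / (INR (S k) - INR (S j))) (S k + d) =
  harmonic k - harmonic d.
Proof.
  induction d as [|d IH].
  - rewrite Nat.add_0_r, psum_S, Nat.eqb_refl.
    change (harmonic 0) with 0. rewrite Rplus_0_r, Rminus_0_r, psum_rev.
    apply psum_ext_lt; intros j Hj.
    destruct (Nat.eqb_spec k (k - 1 - j)) as [E|D]; [lia|].
    f_equal.  rewrite <- minus_INR by lia. f_equal; lia.
  - rewrite Nat.add_succ_r, psum_S, harmonic_S.
    rewrite IH. destruct (Nat.eqb_spec k (S k + d)) as [E|D]; [lia|].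
    replace (INR (S k) - INR (S (S k + d))) with (- INR (S d)).
    + rewrite Rinv_opp; ring.
    + rewrite (S_INR (S k + d)), plus_INR, (S_INR d); ring.
Qed.

(** With x = k + 1 and y = j + 1, x/(y (x - y)) = 1/y + 1/(x - y). Of the two subtracted copies of
    1/x, one is the omitted diagonal term of the sum of 1/y, the other turns H_(x-1) into H_x. *)
Lemma psum_kernel (k n : nat) :
  (k < n)%nat ->
  psum (fun j => if Nat.eqb k j then 0 else
    INR (S k) / (INR (S j) * (INR (S k) - INR (S j)))) n =
  harmonic (S k) - 2 / INR (S k) + (harmonic n - harmonic (n - S k)).
Proof.
  intros Hk.
  rewrite psum_ext with (v := fun j =>
    (if Nat.eqb k j then 0 else / INR (S j)) +
    (if Nat.eqb k j then 0 else / (INR (S k) - INR (S j)))).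
  - rewrite psum_plus.
    assert (E := psum_diag (fun j => / INR (S j)) k n Hk).
    change (psum (fun j => / INR (S j)) n) with (harmonic n) in E.
    assert (F := psum_inv_diff k (n - S k)).
    replace (S k + (n - S k))%nat with n in F by lia.
    rewrite F, harmonic_S. unfold Rdiv. lra.
  - intros j. destruct (Nat.eqb_spec k j) as [E|D]; [ring|].
    assert (Z := INR_S_diff_neq0 k j D). assert (Y := INR_S_neq0 j).
    field; auto.
Qed.

Lemma divdiff_sum_kernel (phi : nat -> R) (n : nat) :
  divdiff_sum phi n =
  2 * psum (fun k => phi k / INR (S k) ^ 2 *
    (harmonic (S k) - 2 / INR (S k) + (harmonic n - harmonic (n - S k)))) n.
Proof.
  set (G := fun k j => if Nat.eqb k j then 0 else
    phi k / (INR (S k) * INR (S j) * (INR (S k) - INR (S j)))).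
  assert (E : divdiff_sum phi n = psum (fun k => psum (fun j => G k j + G j k) n) n).
  { apply psum_ext; intros k; apply psum_ext; intros j; unfold G.
    rewrite (Nat.eqb_sym j k). destruct (Nat.eqb_spec k j) as [E|D]; [ring|].
    assert (Z := INR_S_diff_neq0 k j D). assert (Z' := INR_S_diff_neq0 j k (not_eq_sym D)).
    assert (Y := INR_S_neq0 j). assert (Y' := INR_S_neq0 k). field; auto. }
  rewrite E. rewrite psum_ext with (v := fun k => psum (G k) n + psum (fun j => G j k) n)
    by (intros k; apply psum_plus).
  rewrite psum_plus, <- (psum_swap G n n).
  replace (psum (fun k => psum (G k) n) n) with
    (psum (fun k => phi k / INR (S k) ^ 2 *
    (harmonic (S k) - 2 / INR (S k) + (harmonic n - harmonic (n - S k)))) n); [ring|].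
  apply psum_ext_lt; intros k Hk.
  rewrite <- psum_kernel by exact Hk. rewrite <- psum_scal. apply psum_ext; intros j.
  unfold G. destruct (Nat.eqb_spec k j) as [F|D]; [ring|].
  assert (Z := INR_S_diff_neq0 k j D).
  assert (Y := INR_S_neq0 j). assert (Y' := INR_S_neq0 k). field; auto.
Qed.

(* By symmetry only the [phi k] half matters, and there the inner sum over j is
   evaluated by [psum_kernel]; the boundary term H_n - H_(n-k-1) tends to 0. *)
Lemma divdiff_sum_lim (phi : nat -> R) (C : R) :
  (forall k, Rabs (phi k) <= C / INR (S k)) ->
  is_lim_seq (divdiff_sum phi)
    (2 * Series (fun k => phi k / INR (S k) ^ 2 * (harmonic (S k) - 2 / INR (S k)))).
Proof.
  intros B.
  apply is_lim_seq_ext with (u := fun n => 2 * psum (fun k => phi k / INR (S k) ^ 2 *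
    (harmonic (S k) - 2 / INR (S k) + (harmonic n - harmonic (n - S k)))) n).
  { intros n; symmetry; apply divdiff_sum_kernel. }
  apply (is_lim_seq_scal_l _ 2 (Series (fun k => phi k / INR (S k) ^ 2 * (harmonic (S k) - 2 / INR (S k))))).
  assert (C0 : 0 <= C).
  { specialize (B O); simpl in B. assert (Z := Rabs_pos (phi O)). lra. }
  apply (tannery_psum (fun n k => phi k / INR (S k) ^ 2 *
    (harmonic (S k) - 2 / INR (S k) + (harmonic n - harmonic (n - S k)))) _
    (fun k => (4 * C) * hdom k)).
  - apply ex_series_scal_R, ex_series_hdom.
  - intros n k Hk.
    (* With K = k + 1, the bracket is at most 4 K in absolute value, because H_K and H_n - H_(n-K)
       lie in [0, K] and 2/K is at most 2. The decay C/K of [phi] absorbs this growth. *)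
    apply Rle_trans with ((C / INR (S k)) * / INR (S k) ^ 2 * (4 * INR (S k))).
    + unfold Rdiv at 1. rewrite !Rabs_mult.
      assert (P := inv_pow_le (INR (S k)) 0 2 (INR_S_ge1 k) ltac:(lia)).
      rewrite (Rabs_pos_eq (/ _)) by lra.
      apply Rmult_le_compat; try apply Rabs_pos.
      * apply Rmult_le_pos; [apply Rabs_pos | lra].
      * apply Rmult_le_compat_r; [lra | apply B].
      * assert (Z1 := harmonic_diff_bounds (n - S k) (S k)).
        replace (n - S k + S k)%nat with n in Z1 by lia.
        assert (Z2 := harmonic_le_INR (S k)). assert (Z3 := harmonic_ge0 (S k)).
        assert (Z4 := inv_INR_S_bounds k). assert (Z5 := INR_S_ge1 k).
        unfold Rdiv. apply Rabs_le; lra.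
    + assert (I := inv_sq_le_hdom k). assert (N := INR_S_neq0 k).
      replace (C / INR (S k) * / INR (S k) ^ 2 * (4 * INR (S k)))
        with (4 * C * / INR (S k) ^ 2) by (field; auto).
      apply Rmult_le_compat_l; lra.
  - intros k.
    apply (is_lim_seq_scal_l _ (phi k / INR (S k) ^ 2) (harmonic (S k) - 2 / INR (S k))).
    replace (Finite (harmonic (S k) - 2 / INR (S k)))
      with (Finite (harmonic (S k) - 2 / INR (S k) + 0)) by (f_equal; ring).
    apply is_lim_seq_plus'; [apply is_lim_seq_const|].
    apply (is_lim_seq_incr_n _ (S k)).
    apply is_lim_seq_ext with (2 := harmonic_diff_lim (S k)).
    intros m; do 2 f_equal; lia.
Qed.

(** * Partial fractions of Psi^2 / a^q *)

(* Satisfied by 0 and by the half-integers. *)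
Definition far (a : R) : Prop := forall k, / 2 <= Rabs (a - INR (S k)).

Lemma far_0 : far 0.
Proof.
  intros k. rewrite Rabs_minus_sym, Rminus_0_r.
  assert (Z := INR_S_ge1 k). rewrite Rabs_pos_eq; lra.
Qed.

Lemma far_neq0 (a : R) (k : nat) : far a -> a - INR (S k) <> 0.
Proof. intros F E. specialize (F k). rewrite E, Rabs_R0 in F; lra. Qed.

Lemma far_inv_le2 (a : R) (k : nat) : far a -> Rabs (/ (a - INR (S k))) <= 2.
Proof.
  intros F. rewrite Rabs_inv, <- (Rinv_inv 2).
  apply Rinv_le_contravar; [lra | apply F].
Qed.

(** With y = |a - K| >= 1/2, the triangle inequality gives K <= y + |a| <= (1 + 2 |a|) y. *)
Lemma far_inv_le (a : R) (k : nat) :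
  far a -> Rabs (/ (a - INR (S k))) <= (1 + 2 * Rabs a) / INR (S k).
Proof.
  intros F. rewrite Rabs_inv. assert (Z := INR_S_ge1 k).
  assert (G := F k). set (y := Rabs (a - INR (S k))) in *.
  assert (T : INR (S k) <= y + Rabs a).
  { unfold y. rewrite Rabs_minus_sym.
    assert (T := Rabs_triang (INR (S k) - a) a).
    replace (INR (S k) - a + a) with (INR (S k)) in T by ring.
    rewrite (Rabs_pos_eq (INR (S k))) in T; lra. }
  assert (A := Rabs_pos a).
  apply Rmult_le_reg_r with (INR (S k)); [lra|].
  unfold Rdiv; rewrite Rmult_assoc, (Rinv_l (INR (S k))), Rmult_1_r by lra.
  apply Rmult_le_reg_l with y; [lra|].
  rewrite <- Rmult_assoc, Rinv_r, Rmult_1_l by lra. nra.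
Qed.

Lemma ex_series_inv_pow (s : nat) :
  (2 <= s)%nat -> ex_series (fun k => / INR (S k) ^ s).
Proof.
  intros Hs. apply (ex_series_bound hdom _ 1 ex_series_hdom). intros k.
  assert (P := inv_pow_le (INR (S k)) 2 s (INR_S_ge1 k) Hs).
  assert (Q := inv_sq_le_hdom k). rewrite Rabs_pos_eq; lra.
Qed.

Lemma ex_series_harmonic_div_pow (s : nat) :
  (2 <= s)%nat -> ex_series (fun k => harmonic (S k) / INR (S k) ^ s).
Proof.
  intros Hs. apply (ex_series_bound hdom _ 1 ex_series_hdom). intros k.
  assert (P := inv_pow_le (INR (S k)) 2 s (INR_S_ge1 k) Hs).
  assert (H1 := harmonic_S_ge1 k). unfold hdom, Rdiv.
  rewrite Rabs_pos_eq by (apply Rmult_le_pos; lra).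
  rewrite Rmult_1_l. apply Rmult_le_compat_l; lra.
Qed.

(** The numerator may grow like H_K, so that simple poles with constant or harmonic coefficients and
    double poles, whose numerator is 1/(a - K), are covered at once. *)
Lemma ex_series_pole (x : nat -> R) (c a : R) (m : nat) :
  far a -> (1 <= m)%nat -> (forall k, Rabs (x k) <= c * harmonic (S k)) ->
  ex_series (fun k => x k / (INR (S k) ^ m * (a - INR (S k)))).
Proof.
  intros F Hm X.
  apply (ex_series_bound hdom _ (c * (1 + 2 * Rabs a)) ex_series_hdom). intros k.
  assert (N := far_neq0 a k F). assert (I := far_inv_le a k F).
  assert (P := inv_pow_le (INR (S k)) 1 m (INR_S_ge1 k) Hm).
  assert (Z := INR_S_neq0 k). rewrite pow_1 in P.
  replace (x k / (INR (S k) ^ m * (a - INR (S k))))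
    with (x k * (/ INR (S k) ^ m * / (a - INR (S k)))) by (field; split; auto; apply pow_nonzero, Z).
  rewrite !Rabs_mult, (Rabs_pos_eq (/ _ ^ _)) by lra.
  replace (c * (1 + 2 * Rabs a) * hdom k)
    with ((c * harmonic (S k)) * (/ INR (S k) * ((1 + 2 * Rabs a) / INR (S k))))
    by (unfold hdom; field; auto).
  apply Rmult_le_compat; [apply Rabs_pos | | apply X |].
  - apply Rmult_le_pos; [lra | apply Rabs_pos].
  - apply Rmult_le_compat; [lra | apply Rabs_pos | lra | exact I].
Qed.

Lemma ex_series_pole1 (a : R) (m : nat) :
  far a -> (1 <= m)%nat -> ex_series (fun k => / (INR (S k) ^ m * (a - INR (S k)))).
Proof.
  intros F Hm.
  apply ex_series_ext_R with (fun k => 1 / (INR (S k) ^ m * (a - INR (S k)))).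
  - intros k; apply Rmult_1_l.
  - apply (ex_series_pole (fun _ => 1) 1); auto.
    intros k; rewrite Rabs_R1. assert (Z := harmonic_S_ge1 k); lra.
Qed.

Lemma ex_series_pole_harmonic (a : R) (m : nat) :
  far a -> (1 <= m)%nat ->
  ex_series (fun k => harmonic (S k) / (INR (S k) ^ m * (a - INR (S k)))).
Proof.
  intros F Hm. apply (ex_series_pole (fun k => harmonic (S k)) 1); auto.
  intros k; assert (Z := harmonic_S_ge1 k); rewrite Rabs_pos_eq; lra.
Qed.

Lemma ex_series_pole2 (a : R) (m : nat) :
  far a -> (1 <= m)%nat ->
  ex_series (fun k => / (INR (S k) ^ m * (a - INR (S k)) ^ 2)).
Proof.
  intros F Hm.
  apply ex_series_ext_R with
    (fun k => / (a - INR (S k)) / (INR (S k) ^ m * (a - INR (S k)))).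
  - intros k. assert (N := far_neq0 a k F). assert (Z := INR_S_neq0 k).
    field; split; auto; apply pow_nonzero, Z.
  - apply (ex_series_pole (fun k => / (a - INR (S k))) 2); auto.
    intros k; assert (Z := harmonic_S_ge1 k); assert (I := far_inv_le2 a k F); lra.
Qed.

(* With K = k + 1, the contribution of the double pole at K to the partial
   fraction expansion of Psi(a)^2 / a^q: near K, Psi(s) = 1/(s-K) + (H_K + L) + O(s-K). *)
Definition pole_term (L : R) (q : nat) (a : R) (k : nat) : R :=
  2 * (harmonic (S k) + L) / (INR (S k) ^ q * (a - INR (S k)))
  + / (INR (S k) ^ q * (a - INR (S k)) ^ 2)
  - INR q / (INR (S k) ^ (q + 1) * (a - INR (S k))).

Definition pole_series (L : R) (q : nat) (a : R) : R := Series (pole_term L q a).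

Lemma is_series_pole_term (L : R) (q : nat) (a : R) :
  far a -> (1 <= q)%nat ->
  is_series (pole_term L q a)
    (2 * Series (fun k => harmonic (S k) / (INR (S k) ^ q * (a - INR (S k))))
     + 2 * L * Series (fun k => / (INR (S k) ^ q * (a - INR (S k))))
     + Series (fun k => / (INR (S k) ^ q * (a - INR (S k)) ^ 2))
     - INR q * Series (fun k => / (INR (S k) ^ (q + 1) * (a - INR (S k))))).
Proof.
  intros F Hq. apply is_series_psum.
  assert (E1 := Series_psum_lim _ (ex_series_pole_harmonic a q F Hq)).
  assert (E2 := Series_psum_lim _ (ex_series_pole1 a q F Hq)).
  assert (E3 := Series_psum_lim _ (ex_series_pole2 a q F Hq)).
  assert (E4 := Series_psum_lim _ (ex_series_pole1 a (q + 1) F ltac:(lia))).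
  eapply is_lim_seq_ext; [|apply is_lim_seq_minus';
    [apply is_lim_seq_plus'; [apply is_lim_seq_plus'|]|]].
  2: apply (is_lim_seq_scal_R 2 _ _ E1).
  2: apply (is_lim_seq_scal_R (2 * L) _ _ E2).
  2: apply E3.
  2: apply (is_lim_seq_scal_R (INR q) _ _ E4).
  intros n; cbv beta. rewrite <- !psum_scal, <- !psum_plus, <- psum_minus.
  apply psum_ext; intros k. unfold pole_term.
  assert (N := far_neq0 a k F). assert (Z := INR_S_neq0 k).
  field; repeat split; auto; apply pow_nonzero, Z.
Qed.

Lemma ex_series_pole_term (L : R) (q : nat) (a : R) :
  far a -> (1 <= q)%nat -> ex_series (pole_term L q a).
Proof. intros F Hq; eexists; apply is_series_pole_term; auto. Qed.

(** Termwise: [pole_term L q a k] and a times [pole_term L (S q) a k] have the same principal part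
    at K = k + 1, that of Psi(s)^2 / s^q, and both stay bounded at infinity. Their difference is
    thus constant in a and can be read off at a = 0. *)
Lemma pole_series_step (L : R) (q : nat) (a : R) :
  far a -> (1 <= q)%nat ->
  pole_series L q a = pole_series L q 0 + a * pole_series L (S q) a.
Proof.
  intros F Hq. unfold pole_series.
  rewrite <- Series_scal_l, <- Series_plus.
  - apply Series_ext; intros k. unfold pole_term.
    assert (N := far_neq0 a k F). assert (Z := INR_S_neq0 k).
    rewrite (S_INR q), Nat.add_succ_l, <- !tech_pow_Rmult, (pow_add _ q 1), pow_1.
    set (x := INR (S k)) in *. set (y := x ^ q).
    assert (y <> 0) by (apply pow_nonzero, Z).
    field; repeat split; auto; lra.
  - apply ex_series_pole_term; auto using far_0.
  - apply ex_series_scal_R.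
    apply ex_series_pole_term; auto.
Qed.

(* The sum of zeta(k2+1) zeta(k3+1) over k2 + k3 = j, k2, k3 >= 1, with k2 = i + 1. *)
Definition zeta_conv (j : nat) : R :=
  psum (fun i => zeta (i + 2) * zeta (j - i)) (j - 1).

Lemma geometric_pair (x y : R) (p : nat) :
  (y - x) * psum (fun i => x ^ i * y ^ (p - i)) (S p) = y ^ S p - x ^ S p.
Proof.
  induction p as [|p IH]; [simpl; ring|].
  rewrite psum_S, Nat.sub_diag, pow_O.
  rewrite psum_ext_lt with (v := fun i => y * (x ^ i * y ^ (p - i))).
  - rewrite psum_scal.
    replace ((y - x) * (y * psum (fun i => x ^ i * y ^ (p - i)) (S p) + x ^ S p * 1))
      with (y * ((y - x) * psum (fun i => x ^ i * y ^ (p - i)) (S p)) + (y - x) * x ^ S p)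
      by ring.
    rewrite IH. simpl; ring.
  - intros i Hi. replace (S p - i)%nat with (S (p - i)) by lia. simpl; ring.
Qed.

Lemma zeta_psum_lim (s : nat) :
  (2 <= s)%nat -> is_lim_seq (psum (fun k => / INR (S k) ^ s)) (zeta s).
Proof. intros Hs; apply Series_psum_lim, ex_series_inv_pow, Hs. Qed.

(** Euler's formula for the sum of H_k / k^(p+3). In the truncated products the diagonal gives p + 1
    copies of zeta(p + 4); off the diagonal, the geometric sum over i collapses to minus a divided
    difference of x^(-p-1). The extra 4 comes from the -2/K in [divdiff_sum_lim]. *)
Lemma zeta_conv_euler (p : nat) :
  zeta_conv (S (S p)) =
  (INR (S p) + 4) * zeta (p + 4)
  - 2 * Series (fun k => harmonic (S k) / INR (S k) ^ (p + 3)).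
Proof.
  set (phi := fun k => / INR (S k) ^ S p).
  assert (B : forall k, Rabs (phi k) <= 1 / INR (S k)).
  { intros k; unfold phi.
    assert (P := inv_pow_le (INR (S k)) 1 (S p) (INR_S_ge1 k) ltac:(lia)).
    rewrite pow_1 in P. rewrite Rabs_pos_eq; lra. }
  assert (D := divdiff_sum_lim phi 1 B).
  assert (Zl := zeta_psum_lim (p + 4) ltac:(lia)).
  assert (Fin : forall n,
    psum (fun i => psum (fun k => / INR (S k) ^ (i + 2)) n
                   * psum (fun k => / INR (S k) ^ (S (S p) - i)) n) (S p) =
    INR (S p) * psum (fun k => / INR (S k) ^ (p + 4)) n - divdiff_sum phi n).
  { intros n.
    rewrite psum_ext with (v := fun i => psum (fun k => psum (fun j =>
      / INR (S k) ^ (i + 2) * / INR (S j) ^ (S (S p) - i)) n) n)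
      by (intros i; apply psum_mult).
    rewrite psum_swap.
    rewrite psum_ext with (v := fun k => psum (fun j => psum (fun i =>
      / INR (S k) ^ (i + 2) * / INR (S j) ^ (S (S p) - i)) (S p)) n)
      by (intros k; apply psum_swap).
    rewrite psum_psum_diag. unfold Rminus; f_equal.
    - rewrite <- psum_scal. apply psum_ext; intros k.
      rewrite <- psum_const. apply psum_ext_lt; intros i Hi.
      rewrite <- Rinv_mult, <- pow_add. do 2 f_equal; lia.
    - unfold divdiff_sum. match goal with |- _ = - ?x => replace (- x) with (-1 * x) by ring end.
      rewrite <- psum_scal.
      apply psum_ext; intros k. rewrite <- psum_scal. apply psum_ext; intros j.
      destruct (Nat.eqb_spec k j) as [E|NE]; [ring|].
      assert (Y := INR_S_diff_neq0 k j NE).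
      assert (Z1 := INR_S_neq0 k). assert (Z2 := INR_S_neq0 j).
      assert (G := geometric_pair (/ INR (S k)) (/ INR (S j)) p).
      rewrite psum_ext_lt with (v := fun i => (/ INR (S k)) ^ 2 * (/ INR (S j)) ^ 2 *
        ((/ INR (S k)) ^ i * (/ INR (S j)) ^ (p - i))).
      + rewrite psum_scal. unfold phi. rewrite <- !pow_inv.
        set (x := INR (S k)) in *. set (y := INR (S j)) in *.
        set (s := psum _ _) in *.
        assert (Q : (/ x) ^ S p - (/ y) ^ S p = - ((/ y - / x) * s)) by (rewrite G; ring).
        rewrite Q. field; auto.
      + intros i Hi. rewrite <- !pow_inv.
        replace (S (S p) - i)%nat with (2 + (p - i))%nat by lia.
        rewrite !pow_add; ring. }
  assert (L1 : is_lim_seq (fun n =>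
    psum (fun i => psum (fun k => / INR (S k) ^ (i + 2)) n
                   * psum (fun k => / INR (S k) ^ (S (S p) - i)) n) (S p))
    (zeta_conv (S (S p)))).
  { unfold zeta_conv. replace (S (S p) - 1)%nat with (S p) by lia.
    clear. assert (A : forall m, (m <= S p)%nat -> is_lim_seq (fun n =>
    psum (fun i => psum (fun k => / INR (S k) ^ (i + 2)) n
                   * psum (fun k => / INR (S k) ^ (S (S p) - i)) n) m)
     (psum (fun i => zeta (i + 2) * zeta (S (S p) - i)) m)); [|apply A; lia].
    induction m as [|m IH]; intros Hm.
    - apply is_lim_seq_const.
    - apply (is_lim_seq_plus' (fun n => psum (fun i => psum (fun k => / INR (S k) ^ (i + 2)) n
                   * psum (fun k => / INR (S k) ^ (S (S p) - i)) n) m)); [apply IH; lia|].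
      apply is_lim_seq_mult'; apply zeta_psum_lim; lia. }
  assert (L2 := is_lim_seq_ext _ _ _ Fin L1).
  assert (L3 := is_lim_seq_minus' _ _ _ _ (is_lim_seq_scal_R (INR (S p)) _ _ Zl) D).
  rewrite (is_lim_seq_unique_R _ _ _ L2 L3).
  assert (W : Series (fun k => phi k / INR (S k) ^ 2 * (harmonic (S k) - 2 / INR (S k)))
    = Series (fun k => harmonic (S k) / INR (S k) ^ (p + 3)) - 2 * zeta (p + 4)).
  { unfold zeta, Series1. rewrite <- Series_scal_l, <- Series_minus.
    - apply Series_ext; intros k. unfold phi. assert (Z1 := INR_S_neq0 k).
      replace (S p) with (p + 1)%nat by lia. rewrite !pow_add.
      field; split; auto; apply pow_nonzero, Z1.
    - apply ex_series_harmonic_div_pow; lia.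
    - apply ex_series_scal_R.
      apply ex_series_inv_pow; lia. }
  rewrite W; ring.
Qed.

(* The coefficient of a^j in the Laurent expansion of Psi(a)^2 at 0, for j >= 0. *)
Definition psi_sq_coef (L : R) (j : nat) : R :=
  (match j with O => L ^ 2 | _ => - 2 * L * zeta (j + 1) end)
  - 2 * zeta (j + 2) + zeta_conv j.

(** Euler's formula identifies the constant split off by [pole_series_step] with the next Laurent
    coefficient of Psi^2 at 0. *)
Lemma pole_series_0 (L : R) (q : nat) :
  (2 <= q)%nat -> pole_series L q 0 = psi_sq_coef L q.
Proof.
  intros Hq. destruct q as [|[|p]]; try lia.
  unfold psi_sq_coef. rewrite zeta_conv_euler.
  assert (E3 := Series_psum_lim _ (ex_series_harmonic_div_pow (p + 3) ltac:(lia))).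
  assert (E1 := zeta_psum_lim (p + 3) ltac:(lia)).
  assert (E2 := zeta_psum_lim (p + 4) ltac:(lia)).
  replace (S (S p) + 1)%nat with (p + 3)%nat by lia.
  replace (S (S p) + 2)%nat with (p + 4)%nat by lia.
  unfold pole_series. apply is_series_unique, is_series_psum.
  assert (E4 := is_lim_seq_plus' _ _ _ _ (is_lim_seq_plus' _ _ _ _
    (is_lim_seq_scal_R (-2) _ _ E3) (is_lim_seq_scal_R (- 2 * L) _ _ E1))
    (is_lim_seq_scal_R (INR (S (S p)) + 1) _ _ E2)).
  match goal with |- is_lim_seq _ (Finite ?x) =>
    match type of E4 with is_lim_seq _ (Finite ?y) => replace x with y by (rewrite (S_INR (S p)); ring) end end.
  apply is_lim_seq_ext with (2 := E4). intros n; cbv beta.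
  rewrite <- !psum_scal, <- !psum_plus. apply psum_ext; intros k. unfold pole_term.
  assert (Z := INR_S_neq0 k).
  replace (S (S p)) with (p + 2)%nat by lia. rewrite !pow_add, !pow_1.
  field; split; auto; apply pow_nonzero, Z.
Qed.

(* Psi of the header, with 1/k + 1/(a-k) = a / (k (a-k)). *)
Definition psi_shift (L a : R) : R :=
  / a + L + a * Series (fun k => / (INR (S k) * (a - INR (S k)))).

Lemma pole_reduce (a : R) (m : nat) :
  far a -> (1 <= m)%nat ->
  Series (fun k => / (INR (S k) ^ m * (a - INR (S k)))) =
  - zeta (m + 1) + a * Series (fun k => / (INR (S k) ^ (m + 1) * (a - INR (S k)))).
Proof.
  intros F Hm. rewrite <- Series_scal_l, Rplus_comm.
  unfold zeta, Series1. match goal with |- _ = ?x + - ?y => change (x + - y) with (x - y) end.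
  rewrite <- Series_minus.
  - apply Series_ext; intros k. assert (Z := INR_S_neq0 k). assert (N := far_neq0 a k F).
    rewrite pow_add, pow_1. field; repeat split; auto; apply pow_nonzero, Z.
  - apply ex_series_scal_R, ex_series_pole1; auto; lia.
  - apply ex_series_inv_pow; lia.
Qed.

(** The diagonal of the square yields the double poles, and the divided differences of 1/(a - K)
    yield the simple ones. The two subtracted series adjust the simple-pole coefficients of
    [pole_series L 2 a]: one removes the part with L, the other changes -2/K^3 into -4/K^3. *)
Lemma pole_sq (L a : R) :
  far a ->
  Series (fun k => / (INR (S k) ^ 1 * (a - INR (S k)))) ^ 2 =
  pole_series L 2 a
  - 2 * L * Series (fun k => / (INR (S k) ^ 2 * (a - INR (S k))))
  - 2 * Series (fun k => / (INR (S k) ^ 3 * (a - INR (S k)))).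
Proof.
  intros F. set (phi := fun k => / (a - INR (S k))).
  assert (D := divdiff_sum_lim phi (1 + 2 * Rabs a) (fun k => far_inv_le a k F)).
  assert (X := Series_psum_lim _ (ex_series_pole1 a 1 F ltac:(lia))).
  assert (E3 := Series_psum_lim _ (ex_series_pole2 a 2 F ltac:(lia))).
  assert (L1 := is_lim_seq_mult' _ _ _ _ X X).
  assert (L2 := is_lim_seq_plus' _ _ _ _ E3 D).
  assert (Fin : forall n,
    psum (fun k => / (INR (S k) ^ 1 * (a - INR (S k)))) n *
    psum (fun k => / (INR (S k) ^ 1 * (a - INR (S k)))) n =
    psum (fun k => / (INR (S k) ^ 2 * (a - INR (S k)) ^ 2)) n + divdiff_sum phi n).
  { intros n. rewrite psum_mult, psum_psum_diag. f_equal.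
    - apply psum_ext; intros k. assert (Z := INR_S_neq0 k). assert (N := far_neq0 a k F).
      field; auto.
    - apply psum_ext; intros k; apply psum_ext; intros j.
      destruct (Nat.eqb_spec k j) as [E|NE]; [reflexivity|].
      assert (Y := INR_S_diff_neq0 k j NE). unfold phi.
      assert (Z := INR_S_neq0 k). assert (N := far_neq0 a k F).
      assert (Z' := INR_S_neq0 j). assert (N' := far_neq0 a j F).
      field; auto. }
  assert (L3 := is_lim_seq_unique_R _ _ _ (is_lim_seq_ext _ _ _ Fin L1) L2).
  assert (W : Series (fun k => phi k / INR (S k) ^ 2 * (harmonic (S k) - 2 / INR (S k)))
    = Series (fun k => harmonic (S k) / (INR (S k) ^ 2 * (a - INR (S k))))
      - 2 * Series (fun k => / (INR (S k) ^ 3 * (a - INR (S k))))).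
  { rewrite <- Series_scal_l, <- Series_minus.
    - apply Series_ext; intros k. unfold phi.
      assert (Z := INR_S_neq0 k). assert (N := far_neq0 a k F). field; auto.
    - apply ex_series_pole_harmonic; auto; lia.
    - apply ex_series_scal_R, ex_series_pole1; auto; lia. }
  rewrite W in L3.
  assert (P := is_series_unique _ _ (is_series_pole_term L 2 a F ltac:(lia))).
  change (Series (pole_term L 2 a)) with (pole_series L 2 a) in P.
  change (2 + 1)%nat with 3%nat in P. change (INR 2) with 2 in P.
  rewrite P, <- Rsqr_pow2. unfold Rsqr. rewrite L3. ring.
Qed.

(** Dividing the expansion for q by a raises every power of 1/a by one, and the constant
    [pole_series L q 0] becomes the new coefficient of 1/a. The base case q = 2 is the square of 1/a
    + L + a X, with X the series in [psi_shift]. *)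
Lemma psi_sq_expansion (L a : R) (q : nat) :
  far a -> a <> 0 -> (2 <= q)%nat ->
  psi_shift L a ^ 2 / a ^ q =
  / a ^ (q + 2) + 2 * L * / a ^ (q + 1)
  + psum (fun i => psi_sq_coef L (q - 1 - i) * / a ^ S i) q
  + pole_series L q a.
Proof.
  intros F A Hq.
  induction q as [|q IH]; [lia|].
  destruct (Nat.eq_dec q 1) as [->|Q].
  - unfold psi_shift.
    rewrite (Series_ext (fun k => / (INR (S k) * (a - INR (S k))))
      (fun k => / (INR (S k) ^ 1 * (a - INR (S k))))) by (intros k; rewrite pow_1; auto).
    assert (E0 := pole_sq L a F).
    assert (E1 := pole_reduce a 1 F ltac:(lia)).
    assert (E2 := pole_reduce a 2 F ltac:(lia)).
    change (1 + 1)%nat with 2%nat in E1. change (2 + 1)%nat with 3%nat in E2.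
    set (X := Series (fun k => / (INR (S k) ^ 1 * (a - INR (S k))))) in *.
    set (R2 := Series (fun k => / (INR (S k) ^ 2 * (a - INR (S k))))) in *.
    set (R3 := Series (fun k => / (INR (S k) ^ 3 * (a - INR (S k))))) in *.
    change (2 - 1 - 0)%nat with 1%nat. simpl psum. unfold psi_sq_coef, zeta_conv. simpl Nat.add. simpl psum.
    set (z2 := zeta 2) in *. set (z3 := zeta 3) in *.
    (* By [pole_reduce], a R2 = X + z2 and a R3 = R2 + z3, so only X, z2 and z3 remain. *)
    assert (V : a ^ 2 * pole_series L 2 a =
      (a * X) ^ 2 + 2 * L * a * (X + z2) * 1 + 2 * (X + z2 + a * z3)).
    { rewrite E1, E2. replace (pole_series L 2 a) with (X ^ 2 + 2 * L * R2 + 2 * R3) by (rewrite E0; ring).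
      rewrite E1, E2; ring. }
    apply Rmult_eq_reg_l with (a ^ 2); [|apply pow_nonzero, A].
    rewrite (Rmult_plus_distr_l _ _ (pole_series L 2 a)), V. simpl pow. field; auto.
  - rewrite (pole_series_step L q a F) in IH by lia.
    rewrite pole_series_0 in IH by lia.
    rewrite psum_S_l. replace (S q - 1 - 0)%nat with q by lia.
    rewrite psum_ext with (v := fun i => / a * (psi_sq_coef L (q - 1 - i) * / a ^ S i)).
    + rewrite psum_scal.
      transitivity (/ a * (psi_shift L a ^ 2 / a ^ q)).
      * rewrite <- (tech_pow_Rmult a q). field; split; auto using pow_nonzero.
      * rewrite IH by lia. rewrite !Nat.add_succ_l, pow_1, <- (tech_pow_Rmult a (q + 2)), <- (tech_pow_Rmult a (q + 1)).
        field; repeat split; auto using pow_nonzero.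
    + intros i. replace (S q - 1 - S i)%nat with (q - 1 - i)%nat by lia.
      rewrite (Rmult_comm (/ a)), Rmult_assoc. f_equal.
      simpl. field; split; auto using pow_nonzero.
Qed.

(** * Half-integers *)

Definition half (n : nat) : R := INR (S n) - / 2.

Lemma half_INR (n : nat) : half n = INR n + / 2.
Proof. unfold half; rewrite S_INR; lra. Qed.

Lemma half_pos (n : nat) : 0 < half n.
Proof. rewrite half_INR; assert (Z := pos_INR n); lra. Qed.

Lemma half_neq0 (n : nat) : half n <> 0.
Proof. assert (Z := half_pos n); lra. Qed.

Lemma half_sub_neq0 (n k : nat) : half n - INR k <> 0.
Proof.
  rewrite half_INR. destruct (Nat.le_gt_cases k n) as [E|E].
  - apply le_INR in E; lra.
  - apply le_INR in E; rewrite S_INR in E; lra.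
Qed.

Lemma far_half (n : nat) : far (half n).
Proof.
  intros k. unfold half. destruct (Nat.le_gt_cases n k) as [E|E].
  - apply le_n_S, le_INR in E. rewrite Rabs_left; lra.
  - apply le_n_S, le_INR in E. rewrite (S_INR (S k)) in E. rewrite Rabs_pos_eq; lra.
Qed.

Lemma far_opp_half (n : nat) : far (- half n).
Proof.
  intros k. assert (Z := half_pos n). assert (Y := INR_S_ge1 k).
  rewrite Rabs_left; lra.
Qed.

Lemma inv_sub_INR_lim (a : R) :
  far a -> is_lim_seq (fun n => / (a - INR n)) 0.
Proof.
  intros F. apply is_lim_seq_incr_1, is_lim_seq_abs_0.
  apply is_lim_seq_le_le with (u := fun _ => 0)
    (w := fun n => (1 + 2 * Rabs a) * / INR (S n)).
  - intros n; split; [apply Rabs_pos | apply far_inv_le, F].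
  - apply is_lim_seq_const.
  - replace 0 with ((1 + 2 * Rabs a) * 0) by ring.
    apply is_lim_seq_scal_R, is_lim_seq_inv_INR_S.
Qed.

Lemma psi_shift_lim (L a : R) :
  far a ->
  is_lim_seq (fun n => / a + L + psum (fun k => / INR (S k) + / (a - INR (S k))) n)
    (psi_shift L a).
Proof.
  intros F. unfold psi_shift. apply is_lim_seq_plus'; [apply is_lim_seq_const|].
  assert (E := Series_psum_lim _ (ex_series_pole1 a 1 F ltac:(lia))).
  rewrite (Series_ext (fun k => / (INR (S k) * (a - INR (S k))))
      (fun k => / (INR (S k) ^ 1 * (a - INR (S k))))) by (intros k; rewrite pow_1; auto).
  apply (is_lim_seq_scal_R a) in E. apply is_lim_seq_ext with (2 := E).
  intros n; cbv beta. rewrite <- psum_scal. apply psum_ext; intros k.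
  assert (Z := INR_S_neq0 k). assert (N := far_neq0 a k F). field; auto.
Qed.

(** The digamma recurrence: shifting a by 1 shifts the poles, so the truncated sums differ by two
    boundary terms, of which 1/(a - 1 - n) tends to 0. *)
Lemma psi_shift_pred (L a : R) :
  far a -> far (a - 1) -> a - 1 <> 0 -> psi_shift L (a - 1) = psi_shift L a - / a.
Proof.
  intros F1 F2 N.
  assert (T : forall n,
    psum (fun k => / INR (S k) + / (a - 1 - INR (S k))) n =
    psum (fun k => / INR (S k) + / (a - INR (S k))) n + (/ (a - 1 - INR n) - / (a - 1))).
  { induction n as [|n IH].
    - simpl; rewrite Rminus_0_r; ring.
    - rewrite !psum_S, IH. rewrite (S_INR n).
      replace (a - (INR n + 1)) with (a - 1 - INR n) by ring. ring. }
  assert (L1 := psi_shift_lim L (a - 1) F2).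
  assert (L2 := psi_shift_lim L a F1).
  assert (L3 := inv_sub_INR_lim (a - 1) F2).
  assert (L4 := is_lim_seq_minus' _ _ _ _ (is_lim_seq_plus' _ _ _ _ L2 L3) (is_lim_seq_const (/ a))).
  replace (psi_shift L a + 0 - / a) with (psi_shift L a - / a) in L4 by ring.
  apply (is_lim_seq_unique_R _ _ _ L1).
  apply is_lim_seq_ext with (2 := L4). intros n; cbv beta. rewrite T; ring.
Qed.

Lemma ln_le_sub1 (y : R) : 0 < y -> ln y <= y - 1.
Proof.
  intros Hy. assert (E := exp_ineq1_le (ln y)). rewrite exp_ln in E; lra.
Qed.

Lemma ln_succ_bounds (x : R) : 0 < x -> / (x + 1) <= ln (x + 1) - ln x <= / x.
Proof.
  intros Hx. split.
  - assert (E := ln_le_sub1 (x / (x + 1)) ltac:(apply Rdiv_lt_0_compat; lra)).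
    rewrite ln_div in E by lra.
    replace (x / (x + 1) - 1) with (- / (x + 1)) in E by (field; lra). lra.
  - assert (E := ln_le_sub1 ((x + 1) / x) ltac:(apply Rdiv_lt_0_compat; lra)).
    rewrite ln_div in E by lra.
    replace ((x + 1) / x - 1) with (/ x) in E by (field; lra). lra.
Qed.

Lemma harmonic_ln_lower (m d : nat) :
  ln (INR (S (m + d))) - ln (INR (S m)) <= harmonic (m + d) - harmonic m.
Proof.
  induction d as [|d IH]; [rewrite Nat.add_0_r; lra|].
  rewrite Nat.add_succ_r, harmonic_S.
  assert (E := ln_succ_bounds (INR (S (m + d))) ltac:(assert (Z := INR_S_ge1 (m + d)); lra)).
  rewrite <- S_INR in E. lra.
Qed.

Lemma harmonic_ln_upper (m d : nat) :
  harmonic (S m + d) - harmonic (S m) <= ln (INR (S m + d)) - ln (INR (S m)).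
Proof.
  induction d as [|d IH]; [rewrite Nat.add_0_r; lra|].
  rewrite Nat.add_succ_r, harmonic_S.
  assert (E := ln_succ_bounds (INR (S m + d)) ltac:(assert (Z := INR_S_ge1 (m + d)); simpl Nat.add; lra)).
  rewrite <- S_INR in E. lra.
Qed.

Lemma harmonic_double_lim :
  is_lim_seq (fun n => harmonic (n + S n) - harmonic n) (ln 2).
Proof.
  (* Starting at n + 1 keeps the argument of the logarithm in the upper bound positive. *)
  apply is_lim_seq_incr_1.
  apply is_lim_seq_le_le with (u := fun _ => ln 2) (w := fun n => ln 2 + / INR (S n)).
  - intros n. assert (Z := INR_S_ge1 n). split.
    + assert (E := harmonic_ln_lower (S n) (S (S n))).
      replace (INR (S (S n + S (S n)))) with (2 * INR (S (S n))) in E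
        by (rewrite (S_INR (S n + _)), plus_INR, (S_INR (S n)); ring).
      rewrite ln_mult in E; [lra | lra | assert (Y := INR_S_ge1 (S n)); lra].
    + assert (E := harmonic_ln_upper n (S (S n))).
      replace (INR (S n + S (S n))) with (2 * INR (S n) * (1 + / (2 * INR (S n)))) in E
        by (rewrite plus_INR, (S_INR (S n)); field; lra).
      assert (P : 0 < / (2 * INR (S n))) by (apply Rinv_0_lt_compat; lra).
      rewrite !ln_mult in E by lra.
      assert (G := ln_le_sub1 (1 + / (2 * INR (S n))) ltac:(lra)).
      rewrite Rinv_mult in *. assert (Q := inv_INR_S_bounds n). lra.
  - apply is_lim_seq_const.
  - replace (Finite (ln 2)) with (Finite (ln 2 + 0)) by (f_equal; ring).
    apply is_lim_seq_plus'; [apply is_lim_seq_const | apply is_lim_seq_inv_INR_S].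
Qed.

(** This forces L = 2 log 2: the truncated sum is 2 - 2 (H_(2n+1) - H_n), its 2 cancels 1/a = -2,
    and L must cancel the limit -2 log 2. *)
Lemma psi_shift_base : psi_shift (2 * ln 2) (- half 0) = 0.
Proof.
  assert (L1 := psi_shift_lim (2 * ln 2) _ (far_opp_half 0)).
  assert (L2 := is_lim_seq_minus' _ _ _ _ (is_lim_seq_const (2 * ln 2))
    (is_lim_seq_scal_R 2 _ _ harmonic_double_lim)).
  replace (2 * ln 2 - 2 * ln 2) with 0 in L2 by ring.
  apply (is_lim_seq_unique_R _ _ _ L1).
  apply is_lim_seq_ext with (2 := L2). intros n; cbv beta.
  assert (E : psum (fun k => / INR (S k) + / (- half 0 - INR (S k))) n =
    2 - 2 * (harmonic (n + S n) - harmonic n)).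
  { induction n as [|n IH].
    - unfold harmonic; simpl; lra.
    - rewrite psum_S, IH. replace (S n + S (S n))%nat with (S (S (n + S n))) by lia.
      rewrite !harmonic_S. rewrite half_INR.
      rewrite (S_INR (S (n + S n))), (S_INR (n + S n)), plus_INR, !S_INR.
      change (INR 0) with 0. assert (Z := pos_INR n). field; lra. }
  rewrite E. unfold half; simpl INR. field.
Qed.

Lemma h_psum (n : nat) : h n = psum (fun k => / half k) n.
Proof. apply sum_n_m_psum. Qed.

Lemma psi_shift_opp_half (n : nat) : psi_shift (2 * ln 2) (- half n) = h n.
Proof.
  rewrite h_psum. induction n as [|n IH]; [apply psi_shift_base|].
  rewrite psum_S, <- IH.
  replace (- half (S n)) with (- half n - 1) by (rewrite !half_INR, S_INR; ring).
  rewrite psi_shift_pred.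
  - rewrite Rinv_opp; ring.
  - apply far_opp_half.
  - replace (- half n - 1) with (- half (S n)) by (rewrite !half_INR, S_INR; ring).
    apply far_opp_half.
  - assert (Z := half_pos n); lra.
Qed.

(** The recurrence step between 1/2 and -1/2 joins the positive half-integers to the negative
    ones. *)
Lemma psi_shift_half (n : nat) : psi_shift (2 * ln 2) (half n) = h (S n).
Proof.
  rewrite h_psum. induction n as [|n IH].
  - assert (E : half 0 - 1 = - half 0) by (unfold half; simpl; lra).
    assert (P := psi_shift_pred (2 * ln 2) (half 0) (far_half 0)).
    rewrite E in P. rewrite psi_shift_base in P. simpl psum.
    assert (N := half_pos 0). specialize (P (far_opp_half 0) ltac:(lra)). lra.
  - assert (E : half (S n) - 1 = half n) by (rewrite !half_INR, S_INR; ring).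
    assert (P := psi_shift_pred (2 * ln 2) (half (S n)) (far_half (S n))).
    rewrite E in P. specialize (P (far_half n) (half_neq0 n)).
    rewrite psum_S. rewrite <- IH, P; ring.
Qed.

(** * Alternating sums of inverse powers of shifted half-integers *)

Definition alt_half (i n : nat) : R := psum (fun j => (-1) ^ j / half j ^ i) n.

Lemma is_lim_seq_pow (u : nat -> R) (l : R) (i : nat) :
  is_lim_seq u l -> is_lim_seq (fun n => u n ^ i) (l ^ i).
Proof.
  intros E; induction i as [|i IH]; [apply is_lim_seq_const|].
  apply is_lim_seq_mult'; auto.
Qed.

Lemma inv_half_lim : is_lim_seq (fun n => / half n) 0.
Proof.
  assert (E := inv_sub_INR_lim (- / 2)).
  apply is_lim_seq_ext with (fun n => -1 * / (- / 2 - INR n)).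
  - intros n. rewrite half_INR. assert (Z := pos_INR n). field; lra.
  - replace 0 with (-1 * 0) by ring. apply is_lim_seq_scal_R, E.
    replace (- / 2) with (- half 0) by (unfold half; simpl; lra). apply far_opp_half.
Qed.

Lemma alt_half_lim (i : nat) : (1 <= i)%nat -> is_lim_seq (alt_half i) (tbar i).
Proof.
  intros Hi. unfold tbar, Series1.
  rewrite (Series_ext _ (fun j => (-1) ^ j / half j ^ i)).
  2:{ intros j. replace (S j - 1)%nat with j by lia. reflexivity. }
  apply Series_psum_lim.
  destruct (alternated_series (fun j => (/ half j) ^ i)) as [l Hl].
  - intros j. apply pow_incr. split.
    + left; apply Rinv_0_lt_compat, half_pos.
    + apply Rinv_le_contravar; [apply half_pos|]. rewrite !half_INR, S_INR; lra.
  - apply is_lim_seq_Reals. replace 0 with (0 ^ i) by (apply pow_i; lia).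
    apply is_lim_seq_pow, inv_half_lim.
  - exists l. apply is_lim_seq_Reals in Hl.
    apply is_lim_seq_ext with (2 := Hl). intros n. rewrite <- sum_n_Reals.
    apply sum_n_ext; intros j. unfold tg_alt, Rdiv. rewrite pow_inv; reflexivity.
Qed.

Lemma tbar_1 : tbar 1 = PI / 2.
Proof.
  assert (E := alt_half_lim 1 (Nat.le_refl 1)).
  rewrite <- Alt_PI_eq. unfold Alt_PI. destruct exist_PI as [l Hl].
  apply is_lim_seq_Reals in Hl.
  apply is_lim_seq_incr_1 in E. apply (is_lim_seq_unique_R _ _ _ E).
  replace (4 * l / 2) with (2 * l) by field.
  apply is_lim_seq_ext with (2 := is_lim_seq_scal_R 2 _ _ Hl).
  intros n; cbv beta. rewrite <- sum_n_Reals, sum_n_psum, <- psum_scal.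
  apply psum_ext; intros j. unfold tg_alt, PI_tg.
  rewrite half_INR, plus_INR, mult_INR, pow_1. simpl INR.
  assert (Z := pos_INR j). field; lra.
Qed.

Lemma alt_half_bounded (i : nat) :
  (1 <= i)%nat -> exists c, 0 < c /\ forall n, Rabs (alt_half i n) <= c.
Proof.
  intros Hi. destruct (maj_by_pos (alt_half i)) as [c [Hc Hb]].
  - exists (tbar i). apply is_lim_seq_Reals, alt_half_lim, Hi.
  - exists c; auto.
Qed.

(* Extends [alt_half i (N - k)] to k > N by the reflection of the half-integers
   [half (- n - 1) = - half n]. *)
Definition alt_half_diff (i N k : nat) : R :=
  if Nat.leb k N then alt_half i (N - k) else (-1) ^ i * alt_half i (k - N).

Lemma pow_m1_sq (n : nat) : (-1) ^ n * (-1) ^ n = 1.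
Proof. rewrite <- Rpow_mult_distr. replace (-1 * -1) with 1 by ring. apply pow1. Qed.

Lemma pow_m1_inv (n : nat) : / (-1) ^ n = (-1) ^ n.
Proof.
  apply Rmult_eq_reg_l with ((-1) ^ n); [|apply pow_nonzero; lra].
  rewrite pow_m1_sq, Rinv_r; auto; apply pow_nonzero; lra.
Qed.

(** The shifted points run through the half-integers between -k and N - k. Each new term moves
    [alt_half_diff] by one index: it removes a reflected term while N < k and adds a positive one
    afterwards. *)
Lemma alt_sum_sub (i k N : nat) :
  psum (fun n => (-1) ^ S n / (half n - INR k) ^ i) N =
  - (-1) ^ k * (alt_half_diff i N k - (-1) ^ i * alt_half i k).
Proof.
  induction N as [|N IH].
  - unfold alt_half_diff. destruct (Nat.leb_spec k 0) as [E|E].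
    + assert (k = 0)%nat by lia; subst. unfold alt_half; simpl; ring.
    + rewrite Nat.sub_0_r; simpl; ring.
  - rewrite psum_S, IH. assert (NZ := half_sub_neq0 N k).
    enough (G : (-1) ^ S N / (half N - INR k) ^ i =
      - (-1) ^ k * (alt_half_diff i (S N) k - alt_half_diff i N k)) by (rewrite G; ring).
    unfold alt_half_diff.
    destruct (Nat.leb_spec k N) as [E|E].
    + replace (Nat.leb k (S N)) with true by (symmetry; apply Nat.leb_le; lia).
      replace (S N - k)%nat with (S (N - k)) by lia.
      unfold alt_half; rewrite psum_S.
      replace (half N - INR k) with (half (N - k))
        by (rewrite !half_INR, minus_INR by lia; ring).
      replace (S N) with (S (k + (N - k))) by lia.
      rewrite <- tech_pow_Rmult, pow_add. unfold Rdiv; ring.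
    (* At k = N + 1 the two branches agree, both being empty sums. *)
    + assert (V : (if Nat.leb k (S N) then alt_half i (S N - k)
                   else (-1) ^ i * alt_half i (k - S N)) = (-1) ^ i * alt_half i (k - S N)).
      { destruct (Nat.leb_spec k (S N)) as [E'|E']; auto.
        assert (k = S N) by lia; subst. rewrite Nat.sub_diag. unfold alt_half; simpl; ring. }
      rewrite V. replace (k - N)%nat with (S (k - S N)) by lia.
      unfold alt_half; rewrite psum_S.
      replace (half N - INR k) with (-1 * half (k - S N))
        by (rewrite !half_INR, minus_INR by lia; rewrite S_INR; lra).
      rewrite Rpow_mult_distr. unfold Rdiv. rewrite Rinv_mult, pow_m1_inv.
      assert (W : (-1) ^ S N = (-1) ^ k * (-1) ^ (k - S N)).
      { rewrite <- pow_add. replace (k + (k - S N))%nat with (S N + ((k - S N) + (k - S N)))%nat by lia.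
        rewrite !pow_add, pow_m1_sq. ring. }
      rewrite W; ring.
Qed.

Lemma alt_sum_add (i k N : nat) :
  psum (fun n => (-1) ^ S n / (half n + INR k) ^ i) N =
  - (-1) ^ k * (alt_half i (N + k) - alt_half i k).
Proof.
  induction N as [|N IH]; [simpl; ring|].
  rewrite psum_S, IH. rewrite Nat.add_succ_l. unfold alt_half at 3. rewrite psum_S.
  fold (alt_half i (N + k)).
  replace (half (N + k)) with (half N + INR k) by (rewrite !half_INR, plus_INR; ring).
  assert (W : (-1) ^ (N + k) * (-1) ^ k = (-1) ^ N)
    by (rewrite pow_add, Rmult_assoc, pow_m1_sq; ring).
  rewrite <- tech_pow_Rmult, <- W. unfold Rdiv; ring.
Qed.

Lemma alt_half_diff_le (i N k : nat) (c : R) :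
  (forall n, Rabs (alt_half i n) <= c) -> Rabs (alt_half_diff i N k) <= c.
Proof.
  intros B. unfold alt_half_diff. destruct (Nat.leb k N); [apply B|].
  rewrite Rabs_mult, pow_1_abs, Rmult_1_l. apply B.
Qed.

Lemma alt_half_diff_lim (i k : nat) :
  (1 <= i)%nat -> is_lim_seq (fun N => alt_half_diff i N k) (tbar i).
Proof.
  intros Hi. apply (is_lim_seq_incr_n _ k).
  apply is_lim_seq_ext with (2 := alt_half_lim i Hi). intros n.
  unfold alt_half_diff. replace (Nat.leb k (n + k)) with true by (symmetry; apply Nat.leb_le; lia).
  f_equal; lia.
Qed.

(** The starting values [alt_half 1 k] of the two shifted sums cancel, as do those of exponent 2 in
    [alt_pole2]. Only partial sums near N - k and N + k survive: their limits add to pi for simple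
    poles and cancel for double ones. *)
Lemma alt_pole1 (k N : nat) :
  psum (fun n => (-1) ^ S n * (/ (half n - INR k) - / (- half n - INR k))) N =
  - (-1) ^ k * (alt_half_diff 1 N k + alt_half 1 (N + k)).
Proof.
  assert (E1 := alt_sum_sub 1 k N). assert (E2 := alt_sum_add 1 k N).
  replace (- (-1) ^ k * (alt_half_diff 1 N k + alt_half 1 (N + k))) with
    (- (-1) ^ k * (alt_half_diff 1 N k - (-1) ^ 1 * alt_half 1 k) +
     - (-1) ^ k * (alt_half 1 (N + k) - alt_half 1 k)) by ring.
  rewrite <- E1, <- E2, <- psum_plus. apply psum_ext; intros n.
  assert (Z := half_sub_neq0 n k). assert (Y := half_pos n). assert (X := pos_INR k).
  field; repeat split; auto; lra.
Qed.

Lemma alt_pole2 (k N : nat) :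
  psum (fun n => (-1) ^ S n * (/ (half n - INR k) ^ 2 - / (- half n - INR k) ^ 2)) N =
  - (-1) ^ k * (alt_half_diff 2 N k - alt_half 2 (N + k)).
Proof.
  assert (E1 := alt_sum_sub 2 k N). assert (E2 := alt_sum_add 2 k N).
  replace (- (-1) ^ k * (alt_half_diff 2 N k - alt_half 2 (N + k))) with
    (- (-1) ^ k * (alt_half_diff 2 N k - (-1) ^ 2 * alt_half 2 k) -
     - (-1) ^ k * (alt_half 2 (N + k) - alt_half 2 k)) by ring.
  rewrite <- E1, <- E2, <- psum_minus. apply psum_ext; intros n.
  assert (Z := half_sub_neq0 n k). assert (Y := half_pos n). assert (X := pos_INR k).
  field; repeat split; auto; lra.
Qed.

Lemma alt_pole1_lim (k : nat) :
  is_lim_seq (fun N => - (-1) ^ k * (alt_half_diff 1 N k + alt_half 1 (N + k)))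
    (- (-1) ^ k * PI).
Proof.
  apply is_lim_seq_scal_R. replace PI with (tbar 1 + tbar 1) by (rewrite tbar_1; field).
  apply is_lim_seq_plus'; [apply alt_half_diff_lim; lia|].
  apply (is_lim_seq_incr_n (alt_half 1) k), alt_half_lim; lia.
Qed.

Lemma alt_pole2_lim (k : nat) :
  is_lim_seq (fun N => - (-1) ^ k * (alt_half_diff 2 N k - alt_half 2 (N + k))) 0.
Proof.
  replace 0 with (- (-1) ^ k * (tbar 2 - tbar 2)) by ring. apply is_lim_seq_scal_R.
  apply is_lim_seq_minus'; [apply alt_half_diff_lim; lia|].
  apply (is_lim_seq_incr_n (alt_half 2) k), alt_half_lim; lia.
Qed.

(** * Alternating sums over the half-integers *)

(** The weights are the residues of pi / cos(pi s) at [half n] and [- half n]. *)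
Definition alt_odd (f : R -> R) (N : nat) : R :=
  psum (fun n => (-1) ^ S n * (f (half n) - f (- half n))) N.

Lemma alt_odd_inv_pow_lim (i : nat) :
  (1 <= i)%nat ->
  is_lim_seq (alt_odd (fun a => / a ^ i)) (- (1 - (-1) ^ i) * tbar i).
Proof.
  intros Hi.
  apply is_lim_seq_ext with
    (2 := is_lim_seq_scal_R (- (1 - (-1) ^ i)) _ _ (alt_half_lim i Hi)).
  intros N. unfold alt_half, alt_odd. rewrite <- psum_scal. apply psum_ext; intros n.
  replace (- half n) with (-1 * half n) by ring.
  rewrite Rpow_mult_distr, Rinv_mult, pow_m1_inv. rewrite <- (tech_pow_Rmult (-1) n). unfold Rdiv; ring.
Qed.

Lemma alt_odd_pole_series (L : R) (q N : nat) :
  (1 <= q)%nat ->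
  alt_odd (pole_series L q) N = Series (fun k =>
    (2 * (harmonic (S k) + L) / INR (S k) ^ q - INR q / INR (S k) ^ (q + 1))
      * (- (-1) ^ S k * (alt_half_diff 1 N (S k) + alt_half 1 (N + S k)))
    + / INR (S k) ^ q
      * (- (-1) ^ S k * (alt_half_diff 2 N (S k) - alt_half 2 (N + S k)))).
Proof.
  intros Hq. symmetry. unfold alt_odd.
  rewrite (psum_ext _ (fun n => Series (fun k => (-1) ^ S n *
    (pole_term L q (half n) k - pole_term L q (- half n) k)))).
  2:{ intros n. rewrite Series_scal_l, Series_minus; auto; apply ex_series_pole_term;
      auto using far_half, far_opp_half. }
  apply is_series_unique.
  eapply is_series_ext; [|apply (is_series_psum_Series (fun n k => (-1) ^ S n *
    (pole_term L q (half n) k - pole_term L q (- half n) k)) N)].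
  - intros k. rewrite <- alt_pole1, <- alt_pole2, <- !psum_scal, <- psum_plus.
    apply psum_ext; intros n. unfold pole_term.
    assert (Z := INR_S_neq0 k). assert (N1 := far_neq0 _ k (far_half n)).
    assert (N2 := far_neq0 _ k (far_opp_half n)).
    field; repeat split; auto using pow_nonzero.
  - intros n. apply ex_series_scal_R.
    apply (ex_series_minus (pole_term L q (half n)) (pole_term L q (- half n)));
      apply ex_series_pole_term; auto using far_half, far_opp_half.
Qed.

Lemma zetabar_lim (s : nat) :
  (2 <= s)%nat -> is_lim_seq (psum (fun k => (-1) ^ S k / INR (S k) ^ s)) (zetabar s).
Proof.
  intros Hs. apply (Series_psum_lim (fun k => (-1) ^ S k / INR (S k) ^ s)).
  apply (ex_series_bound _ _ 1 (ex_series_inv_pow s Hs)). intros k.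
  unfold Rdiv. rewrite Rabs_mult, pow_1_abs.
  assert (P := inv_pow_le (INR (S k)) 0 s (INR_S_ge1 k) ltac:(lia)).
  rewrite Rabs_pos_eq; lra.
Qed.

Lemma zetabar1_lim (s : nat) :
  (2 <= s)%nat ->
  is_lim_seq (psum (fun k => (-1) ^ S k / INR (S k) ^ s * harmonic k)) (zetabar1 s).
Proof.
  intros Hs. unfold zetabar1, Series1.
  rewrite (Series_ext _ (fun k => (-1) ^ S k / INR (S k) ^ s * harmonic k)).
  2:{ intros k. replace (S k - 1)%nat with k by lia. rewrite sum_n_m_psum.
      unfold harmonic. rewrite <- psum_scal. apply psum_ext; intros j.
      assert (Z := INR_S_neq0 k). assert (Y := INR_S_neq0 j).
      field; split; auto using pow_nonzero. }
  apply Series_psum_lim.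
  apply (ex_series_bound hdom _ 1 ex_series_hdom). intros k.
  unfold Rdiv. rewrite !Rabs_mult, pow_1_abs.
  assert (P := inv_pow_le (INR (S k)) 2 s (INR_S_ge1 k) Hs).
  assert (G := harmonic_ge0 k). assert (I := inv_INR_S_bounds k).
  rewrite !Rabs_pos_eq by lra. unfold hdom, Rdiv. rewrite harmonic_S.
  rewrite !Rmult_1_l, (Rmult_comm (/ _)). apply Rmult_le_compat; lra.
Qed.

(** The limit of the series in k has coefficients in H_K; writing H_K = H_(K-1) + 1/K produces
    [zetabar1] and turns the factor q into q - 2. *)
Lemma alt_odd_pole_series_lim (L : R) (q : nat) :
  (2 <= q)%nat ->
  is_lim_seq (alt_odd (pole_series L q))
    ((INR q - 2) * PI * zetabar (q + 1) - 2 * PI * zetabar1 q - 2 * L * PI * zetabar q).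
Proof.
  intros Hq.
  destruct (alt_half_bounded 1) as [c1 [P1 B1]]; [lia|].
  destruct (alt_half_bounded 2) as [c2 [P2 B2]]; [lia|].
  apply is_lim_seq_ext with (u := fun N => Series (fun k =>
    (2 * (harmonic (S k) + L) / INR (S k) ^ q - INR q / INR (S k) ^ (q + 1))
      * (- (-1) ^ S k * (alt_half_diff 1 N (S k) + alt_half 1 (N + S k)))
    + / INR (S k) ^ q
      * (- (-1) ^ S k * (alt_half_diff 2 N (S k) - alt_half 2 (N + S k))))).
  { intros N; symmetry; apply alt_odd_pole_series; lia. }
  set (l := fun k =>
    (2 * (harmonic (S k) + L) / INR (S k) ^ q - INR q / INR (S k) ^ (q + 1))
      * (- (-1) ^ S k * PI) + / INR (S k) ^ q * 0).
  replace ((INR q - 2) * PI * zetabar (q + 1) - 2 * PI * zetabar1 q - 2 * L * PI * zetabar q)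
    with (Series l).
  2:{ apply is_series_unique, is_series_psum.
      assert (E1 := zetabar_lim (q + 1) ltac:(lia)).
      assert (E2 := zetabar1_lim q Hq).
      assert (E3 := zetabar_lim q Hq).
      assert (E := is_lim_seq_minus' _ _ _ _ (is_lim_seq_minus' _ _ _ _
        (is_lim_seq_scal_R ((INR q - 2) * PI) _ _ E1)
        (is_lim_seq_scal_R (2 * PI) _ _ E2))
        (is_lim_seq_scal_R (2 * L * PI) _ _ E3)).
      apply is_lim_seq_ext with (2 := E). intros N; cbv beta.
      rewrite <- !psum_scal, <- !psum_minus. apply psum_ext; intros k. unfold l.
      rewrite harmonic_S, (pow_add _ q 1), pow_1.
      assert (Z := INR_S_neq0 k). field; split; auto using pow_nonzero. }
  (* Since 1 and H_K are both at most H_K and K^(-q) <= K^(-2), the coefficient of the simple pole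
     is at most (2 + 2 |L| + q) [hdom k]; c1 and c2 bound all partial sums [alt_half 1] and
     [alt_half 2]. *)
  apply (tannery _ l (fun k => ((2 + 2 * Rabs L + INR q) * (2 * c1) + 2 * c2) * hdom k)).
  - apply ex_series_scal_R, ex_series_hdom.
  - intros N k.
    assert (A1 : Rabs (- (-1) ^ S k * (alt_half_diff 1 N (S k) + alt_half 1 (N + S k))) <= 2 * c1).
    { rewrite Rabs_mult, Rabs_Ropp, pow_1_abs, Rmult_1_l.
      eapply Rle_trans; [apply Rabs_triang|].
      assert (X := alt_half_diff_le 1 N (S k) c1 B1). specialize (B1 (N + S k)%nat). lra. }
    assert (A2 : Rabs (- (-1) ^ S k * (alt_half_diff 2 N (S k) - alt_half 2 (N + S k))) <= 2 * c2).
    { rewrite Rabs_mult, Rabs_Ropp, pow_1_abs, Rmult_1_l.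
      eapply Rle_trans; [apply Rabs_triang|]. rewrite Rabs_Ropp.
      assert (X := alt_half_diff_le 2 N (S k) c2 B2). specialize (B2 (N + S k)%nat). lra. }
    assert (Q1 := inv_pow_le (INR (S k)) 2 q (INR_S_ge1 k) Hq).
    assert (Q2 := inv_pow_le (INR (S k)) 2 (q + 1) (INR_S_ge1 k) ltac:(lia)).
    assert (H1 := harmonic_S_ge1 k). assert (D := inv_sq_le_hdom k).
    assert (LP := Rabs_pos L). assert (QP := pos_INR q).
    assert (HD : harmonic (S k) * / INR (S k) ^ 2 = hdom k) by reflexivity.
    set (i2 := / INR (S k) ^ 2) in *.
    eapply Rle_trans; [apply Rabs_triang|].
    rewrite Rmult_plus_distr_r. apply Rplus_le_compat.
    + rewrite Rabs_mult.
      replace ((2 + 2 * Rabs L + INR q) * (2 * c1) * hdom k)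
        with ((2 + 2 * Rabs L + INR q) * hdom k * (2 * c1)) by ring.
      apply Rmult_le_compat; try apply Rabs_pos; [|exact A1].
      unfold Rdiv, Rminus. eapply Rle_trans; [apply Rabs_triang|].
      rewrite Rabs_Ropp, !Rabs_mult, (Rabs_pos_eq 2), (Rabs_pos_eq (INR q)) by lra.
      rewrite (Rabs_pos_eq (/ INR (S k) ^ q)), (Rabs_pos_eq (/ INR (S k) ^ (q + 1))) by lra.
      assert (T := Rabs_triang (harmonic (S k)) L). rewrite (Rabs_pos_eq (harmonic (S k))) in T by lra.
      apply Rle_trans with (2 * (harmonic (S k) + Rabs L) * i2 + INR q * i2).
      * apply Rplus_le_compat; apply Rmult_le_compat; try lra.
        assert (Y := Rabs_pos (harmonic (S k) + L)); lra.
      * rewrite Rmult_plus_distr_l, (Rmult_plus_distr_r (2 * _)), (Rmult_assoc 2 (harmonic _)), HD.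
        assert (Rabs L * i2 <= Rabs L * hdom k) by (apply Rmult_le_compat_l; lra).
        assert (INR q * i2 <= INR q * hdom k) by (apply Rmult_le_compat_l; lra).
        lra.
    + rewrite Rabs_mult, (Rabs_pos_eq (/ _)) by lra.
      rewrite Rmult_comm. apply Rmult_le_compat; try lra; apply Rabs_pos.
  - intros k. unfold l. apply is_lim_seq_plus'; apply is_lim_seq_scal_R;
      [apply alt_pole1_lim | apply alt_pole2_lim].
Qed.

Lemma alt_odd_psi_sq_lim (L : R) (q : nat) :
  (2 <= q)%nat ->
  is_lim_seq (alt_odd (fun a => psi_shift L a ^ 2 / a ^ q))
    (- (1 - (-1) ^ (q + 2)) * tbar (q + 2)
     + 2 * L * (- (1 - (-1) ^ (q + 1)) * tbar (q + 1))
     + psum (fun i => psi_sq_coef L (q - 1 - i) * (- (1 - (-1) ^ S i) * tbar (S i))) q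
     + ((INR q - 2) * PI * zetabar (q + 1) - 2 * PI * zetabar1 q - 2 * L * PI * zetabar q)).
Proof.
  intros Hq.
  apply is_lim_seq_ext with (u := fun N =>
    alt_odd (fun a => / a ^ (q + 2)) N + 2 * L * alt_odd (fun a => / a ^ (q + 1)) N
    + psum (fun i => psi_sq_coef L (q - 1 - i) * alt_odd (fun a => / a ^ S i) N) q
    + alt_odd (pole_series L q) N).
  - intros N. unfold alt_odd.
    rewrite (psum_ext (fun i => psi_sq_coef L (q - 1 - i) * psum _ _)
      (fun i => psum (fun n => psi_sq_coef L (q - 1 - i) *
        ((-1) ^ S n * (/ half n ^ S i - / (- half n) ^ S i))) N))
      by (intros i; symmetry; apply psum_scal).
    rewrite psum_swap, <- psum_scal, <- !psum_plus. apply psum_ext; intros n.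
    assert (Z := half_neq0 n).
    rewrite !psi_sq_expansion; auto using far_half, far_opp_half, Ropp_neq_0_compat.
    rewrite (psum_ext (fun i => psi_sq_coef L (q - 1 - i) * _)
      (fun i => (-1) ^ S n * (psi_sq_coef L (q - 1 - i) * / half n ^ S i
        - psi_sq_coef L (q - 1 - i) * / (- half n) ^ S i))) by (intros i; ring).
    rewrite psum_scal, psum_minus. ring.
  - apply is_lim_seq_plus'; [|apply alt_odd_pole_series_lim, Hq].
    apply is_lim_seq_plus'.
    + apply is_lim_seq_plus'; [|apply is_lim_seq_scal_R]; apply alt_odd_inv_pow_lim; lia.
    + apply (psum_lim (fun N i => psi_sq_coef L (q - 1 - i) * alt_odd (fun a => / a ^ S i) N)).
      intros i. apply is_lim_seq_scal_R, alt_odd_inv_pow_lim; lia.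
Qed.

(** * Evaluation of the alternating sum through the values of h *)

Lemma h_bounds (n : nat) : 0 <= h n <= 2 * harmonic n.
Proof.
  rewrite h_psum. unfold harmonic. induction n as [|n IH]; [simpl; lra|].
  rewrite !psum_S.
  assert (Z := half_pos n). assert (Y := INR_S_ge1 n).
  assert (0 < / half n) by (apply Rinv_0_lt_compat, Z).
  assert (/ half n <= 2 * / INR (S n)); [|lra].
  replace (2 * / INR (S n)) with (/ (INR (S n) / 2)) by (field; lra).
  apply Rinv_le_contravar; [lra | unfold half; lra].
Qed.

Lemma inv_half_pow_bounds (n s : nat) : 0 < / half n ^ s <= 2 ^ s * / INR (S n) ^ s.
Proof.
  assert (Z := half_pos n). assert (Y := INR_S_ge1 n).
  split; [apply Rinv_0_lt_compat, pow_lt, Z|].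
  rewrite <- !pow_inv, <- Rpow_mult_distr. apply pow_incr. split.
  - left; apply Rinv_0_lt_compat, Z.
  - replace (2 * / INR (S n)) with (/ (INR (S n) / 2)) by (field; lra).
    apply Rinv_le_contravar; [lra | unfold half; lra].
Qed.

Lemma ttildebar1_lim (s : nat) :
  (2 <= s)%nat ->
  is_lim_seq (psum (fun n => (-1) ^ S n / half n ^ s * h n)) (ttildebar1 s).
Proof.
  intros Hs. unfold ttildebar1, Series1.
  rewrite (Series_ext _ (fun n => (-1) ^ S n / half n ^ s * h n)).
  2:{ intros n. replace (S n - 1)%nat with n by lia. rewrite sum_n_m_psum, h_psum.
      rewrite <- psum_scal. apply psum_ext; intros j.
      assert (Z := half_neq0 n). assert (Y := half_neq0 j).
      fold (half n) (half j). field; split; auto using pow_nonzero. }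
  apply Series_psum_lim.
  apply (ex_series_bound hdom _ (2 ^ s * 2) ex_series_hdom). intros n.
  assert (P := inv_pow_le (INR (S n)) 2 s (INR_S_ge1 n) Hs).
  assert (B := inv_half_pow_bounds n s). assert (G := h_bounds n).
  assert (I := inv_INR_S_bounds n). assert (T : 0 < 2 ^ s) by (apply pow_lt; lra).
  unfold Rdiv. rewrite !Rabs_mult, pow_1_abs, Rmult_1_l, !Rabs_pos_eq by lra.
  replace (2 ^ s * 2 * hdom n) with ((2 ^ s * / INR (S n) ^ 2) * (2 * harmonic (S n)))
    by (unfold hdom, Rdiv; ring).
  apply Rmult_le_compat; try lra.
  - eapply Rle_trans; [apply B|]. apply Rmult_le_compat_l; lra.
  - rewrite harmonic_S; lra.
Qed.

(** One of the two harmonic factors in h^2 is bounded by K, which costs a power of K and leaves the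
    majorant [hdom] for q >= 3. *)
Lemma Tbar_lim (q : nat) :
  (3 <= q)%nat ->
  is_lim_seq (psum (fun n => h n ^ 2 / half n ^ q * (-1) ^ S n)) (Tbar q).
Proof.
  intros Hq. unfold Tbar, Series1.
  rewrite (Series_ext _ (fun n => h n ^ 2 / half n ^ q * (-1) ^ S n)).
  2:{ intros n. replace (S n - 1)%nat with n by lia. reflexivity. }
  apply Series_psum_lim.
  apply (ex_series_bound hdom _ (4 * 2 ^ q) ex_series_hdom). intros n.
  assert (P := inv_pow_le (INR (S n)) 3 q (INR_S_ge1 n) Hq).
  assert (B := inv_half_pow_bounds n q). assert (G := h_bounds n).
  assert (I := inv_INR_S_bounds n). assert (T : 0 < 2 ^ q) by (apply pow_lt; lra).
  assert (M := harmonic_le_INR (S n)). assert (M' := harmonic_S_ge1 n). assert (Y := INR_S_ge1 n).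
  assert (E : h n ^ 2 <= 4 * harmonic (S n) * INR (S n)).
  { assert (h n <= 2 * harmonic (S n)) by (rewrite harmonic_S; lra).
    apply Rle_trans with ((2 * harmonic (S n)) ^ 2); [apply pow_incr; lra|].
    replace ((2 * harmonic (S n)) ^ 2) with (4 * harmonic (S n) * harmonic (S n)) by ring.
    apply Rmult_le_compat_l; lra. }
  unfold Rdiv. rewrite !Rabs_mult, pow_1_abs, Rmult_1_r.
  rewrite (Rabs_pos_eq (/ _)) by lra. rewrite Rabs_pos_eq by apply pow2_ge_0.
  replace (4 * 2 ^ q * hdom n)
    with (4 * harmonic (S n) * INR (S n) * (2 ^ q * / INR (S n) ^ 3))
    by (unfold hdom; field; lra).
  apply Rmult_le_compat; try lra; [apply pow2_ge_0|].
  eapply Rle_trans; [apply B|]. apply Rmult_le_compat_l; lra.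
Qed.

(* For even q both sides vanish, which leaves q >= 3. *)
Lemma parity_Tbar_lim (q : nat) :
  (2 <= q)%nat ->
  is_lim_seq (fun N => (1 + (-1) ^ (q + 1)) * psum (fun n => h n ^ 2 / half n ^ q * (-1) ^ S n) N)
    ((1 + (-1) ^ (q + 1)) * Tbar q).
Proof.
  intros Hq. destruct (Nat.Even_or_Odd q) as [[m E]|[m O]].
  - assert (Z : 1 + (-1) ^ (q + 1) = 0).
    { rewrite E, Nat.add_1_r, pow_1_odd; ring. }
    rewrite Z, Rmult_0_l. apply is_lim_seq_ext with (fun _ => 0); [|apply is_lim_seq_const].
    intros N; ring.
  - apply is_lim_seq_scal_R, Tbar_lim; lia.
Qed.

(** Psi equals h_n at one point and h_(n-1) at the other. Expanding h_n^2 = (h_(n-1) + 1/(n -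
    1/2))^2 gives the three values; the squares of h_(n-1) combine with the factor 1 - (-1)^q. *)
Lemma alt_odd_h_lim (q : nat) :
  (2 <= q)%nat ->
  is_lim_seq (alt_odd (fun a => psi_shift (2 * ln 2) a ^ 2 / a ^ q))
    ((1 + (-1) ^ (q + 1)) * Tbar q + 2 * ttildebar1 (q + 1) + -1 * tbar (q + 2)).
Proof.
  intros Hq.
  assert (E := is_lim_seq_plus' _ _ _ _ (is_lim_seq_plus' _ _ _ _
    (parity_Tbar_lim q Hq) (is_lim_seq_scal_R 2 _ _ (ttildebar1_lim (q + 1) ltac:(lia))))
    (is_lim_seq_scal_R (-1) _ _ (alt_half_lim (q + 2) ltac:(lia)))).
  apply is_lim_seq_ext with (2 := E). intros N; cbv beta. unfold alt_odd, alt_half.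
  rewrite <- !psum_scal, <- !psum_plus. apply psum_ext; intros n.
  rewrite psi_shift_half, psi_shift_opp_half.
  replace (h (S n)) with (h n + / half n) by (rewrite !h_psum, psum_S; reflexivity).
  replace (- half n) with (-1 * half n) by ring. rewrite Rpow_mult_distr.
  unfold Rdiv. rewrite !Rinv_mult, pow_m1_inv. rewrite !pow_add.
  rewrite <- (tech_pow_Rmult (-1) n). assert (Z := half_neq0 n).
  field; auto using pow_nonzero.
Qed.

(** * Reindexing of the constrained sums over k1, k2, k3 *)

Lemma psum_single (u : nat -> R) (c n : nat) :
  psum (fun k => if Nat.eqb k c then u k else 0) n = if Nat.ltb c n then u c else 0.
Proof.
  induction n as [|n IH]; [reflexivity|].
  rewrite psum_S, IH.
  destruct (Nat.eqb_spec n c) as [<-|D].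
  - rewrite Nat.ltb_irrefl. replace (Nat.ltb n (S n)) with true by (symmetry; apply Nat.ltb_lt; lia). ring.
  - destruct (Nat.ltb_spec c n), (Nat.ltb_spec c (S n)); try lia; ring.
Qed.

Lemma psum_trunc (u : nat -> R) (n m : nat) :
  (n <= m)%nat -> psum (fun k => if Nat.ltb k n then u k else 0) m = psum u n.
Proof.
  intros Hm. replace m with (n + (m - n))%nat by lia.
  induction (m - n)%nat as [|d IH].
  - rewrite Nat.add_0_r. apply psum_ext_lt; intros k Hk.
    apply Nat.ltb_lt in Hk; rewrite Hk; reflexivity.
  - rewrite Nat.add_succ_r, psum_S, IH.
    replace (Nat.ltb (n + d) n) with false by (symmetry; apply Nat.ltb_ge; lia). ring.
Qed.

(** The weights 1 - (-1)^(i+1) produced by the two signs of a vanish unless i + 1 is odd, which is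
    the restriction to the arguments 2 k1 - 1 of [tbar]. *)
Lemma psum_even_index (g : nat -> R) (m : nat) :
  2 * psum (fun k => g (2 * k)%nat) m = psum (fun i => (1 - (-1) ^ S i) * g i) (2 * m).
Proof.
  induction m as [|m IH]; [simpl; ring|].
  replace (2 * S m)%nat with (S (S (2 * m))) by lia.
  rewrite !psum_S, <- IH, pow_1_odd.
  replace (S (S (2 * m))) with (2 * S m)%nat by lia. rewrite pow_1_even. ring.
Qed.

Lemma psum_odd_weights (g : nat -> R) (n m : nat) :
  (n <= 2 * m)%nat -> (forall i, (n <= i)%nat -> g i = 0) ->
  2 * psum (fun k => g (2 * k)%nat) m = psum (fun i => (1 - (-1) ^ S i) * g i) n.
Proof.
  intros Hn G. rewrite psum_even_index, <- (psum_trunc _ n (2 * m) Hn).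
  apply psum_ext; intros i. destruct (Nat.ltb_spec i n) as [|E]; auto.
  rewrite G by exact E; ring.
Qed.

Lemma sum_tbar_zeta (N : nat) :
  2 * sum_2k1_k2 N (fun k1 k2 => tbar (2 * k1 - 1) * zeta (k2 + 1)) =
  psum (fun i => (1 - (-1) ^ S i) * (tbar (S i) * zeta (N - 1 - i))) (N - 2).
Proof.
  unfold sum_2k1_k2. rewrite sum_n_m_psum.
  (* From i = N - 2 on, no positive k2 is left, and [zeta (N - 1 - i)] would be taken at 1 or 0;
     hence the cutoff. *)
  set (g := fun i => if Nat.ltb i (N - 2) then tbar (S i) * zeta (N - 1 - i) else 0).
  rewrite (psum_ext _ (fun k => g (2 * k)%nat)).
  - rewrite (psum_odd_weights g (N - 2)); [|lia|].
    + apply psum_ext_lt; intros i Hi. unfold g. apply Nat.ltb_lt in Hi; rewrite Hi; reflexivity.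
    + intros i Hi. unfold g. apply Nat.ltb_ge in Hi; rewrite Hi; reflexivity.
  - intros k. rewrite sum_n_m_psum. unfold g.
    destruct (Nat.ltb_spec (2 * k) (N - 2)) as [E|E].
    (* The constraint 2 (k + 1) + (j + 1) = N leaves the single index j = N - 3 - 2 k. *)
    + rewrite (psum_ext _ (fun j => if Nat.eqb j (N - 3 - 2 * k)
        then tbar (2 * S k - 1) * zeta (S j + 1) else 0)).
      * rewrite psum_single. replace (Nat.ltb (N - 3 - 2 * k) N) with true
          by (symmetry; apply Nat.ltb_lt; lia).
        f_equal; f_equal; lia.
      * intros j. destruct (Nat.eqb_spec (2 * S k + S j) N), (Nat.eqb_spec j (N - 3 - 2 * k)); try lia; auto.
    + rewrite (psum_ext _ (fun _ => 0)); [rewrite psum_const; ring|].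
      intros j. destruct (Nat.eqb_spec (2 * S k + S j) N); [lia|auto].
Qed.

Lemma sum_tbar_zeta_zeta (q : nat) :
  2 * sum_2k1_k2_k3 (q + 1)
        (fun k1 k2 k3 => tbar (2 * k1 - 1) * zeta (k2 + 1) * zeta (k3 + 1)) =
  psum (fun i => (1 - (-1) ^ S i) * (tbar (S i) * zeta_conv (q - 1 - i))) q.
Proof.
  unfold sum_2k1_k2_k3. rewrite sum_n_m_psum.
  (* Out of range the truncated argument of [zeta_conv] is 0, where it is an empty sum, so g
     vanishes there. *)
  set (g := fun i => tbar (S i) * zeta_conv (q - 1 - i)).
  rewrite (psum_ext _ (fun k => g (2 * k)%nat)).
  - apply (psum_odd_weights g q); [lia|].
    intros i Hi. unfold g. replace (q - 1 - i)%nat with 0%nat by lia.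
    unfold zeta_conv; simpl; ring.
  - intros k. rewrite sum_n_m_psum. unfold g, zeta_conv.
    rewrite <- (psum_trunc _ (q - 1 - 2 * k - 1) (q + 1)) by lia.
    rewrite <- psum_scal. apply psum_ext; intros j. rewrite sum_n_m_psum.
    destruct (Nat.ltb_spec j (q - 1 - 2 * k - 1)) as [E|E].
    + rewrite (psum_ext _ (fun l => if Nat.eqb l (q - 3 - 2 * k - j)
        then tbar (2 * S k - 1) * zeta (S j + 1) * zeta (S l + 1) else 0)).
      * rewrite psum_single. replace (Nat.ltb (q - 3 - 2 * k - j) (q + 1)) with true
          by (symmetry; apply Nat.ltb_lt; lia).
        rewrite Rmult_assoc. f_equal; [f_equal; lia|]. f_equal; f_equal; lia.
      * intros l. destruct (Nat.eqb_spec (2 * S k + S j + S l) (q + 1)), (Nat.eqb_spec l (q - 3 - 2 * k - j)); try lia; auto.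
    + rewrite (psum_ext _ (fun _ => 0)); [rewrite psum_const; ring|].
      intros l. destruct (Nat.eqb_spec (2 * S k + S j + S l) (q + 1)); [lia|auto].
Qed.

Lemma psum_psi_sq_coef (L : R) (q : nat) :
  (1 <= q)%nat ->
  psum (fun i => psi_sq_coef L (q - 1 - i) * (- (1 - (-1) ^ S i) * tbar (S i))) q =
  - (1 - (-1) ^ q) * L ^ 2 * tbar q
  - 2 * sum_2k1_k2_k3 (q + 1)
          (fun k1 k2 k3 => tbar (2 * k1 - 1) * zeta (k2 + 1) * zeta (k3 + 1))
  + 4 * sum_2k1_k2 (q + 2) (fun k1 k2 => tbar (2 * k1 - 1) * zeta (k2 + 1))
  + 4 * L * sum_2k1_k2 (q + 1) (fun k1 k2 => tbar (2 * k1 - 1) * zeta (k2 + 1)).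
Proof.
  intros Hq. rewrite sum_tbar_zeta_zeta.
  replace (4 * sum_2k1_k2 (q + 2) (fun k1 k2 => tbar (2 * k1 - 1) * zeta (k2 + 1)))
    with (2 * (2 * sum_2k1_k2 (q + 2) (fun k1 k2 => tbar (2 * k1 - 1) * zeta (k2 + 1)))) by ring.
  replace (4 * L * sum_2k1_k2 (q + 1) (fun k1 k2 => tbar (2 * k1 - 1) * zeta (k2 + 1)))
    with (2 * L * (2 * sum_2k1_k2 (q + 1) (fun k1 k2 => tbar (2 * k1 - 1) * zeta (k2 + 1)))) by ring.
  rewrite !sum_tbar_zeta.
  replace (q + 2 - 2)%nat with q by lia. replace (q + 1 - 2)%nat with (q - 1)%nat by lia.
  destruct q as [|r]; [lia|]. replace (S r - 1)%nat with r by lia.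
  (* The last index i = r meets the coefficient of order 0, which has L^2 in place of -2 L zeta(1).
     It is split off and supplies the term with [tbar q]. *)
  rewrite !psum_S, Nat.sub_diag.
  rewrite (psum_ext_lt _ (fun i =>
    2 * ((1 - (-1) ^ S i) * (tbar (S i) * zeta (S r + 2 - 1 - i)))
    + 2 * L * ((1 - (-1) ^ S i) * (tbar (S i) * zeta (S r + 1 - 1 - i)))
    - (1 - (-1) ^ S i) * (tbar (S i) * zeta_conv (r - i)))).
  - rewrite psum_minus, psum_plus, !psum_scal. unfold psi_sq_coef.
    replace (S r + 2 - 1 - r)%nat with (0 + 2)%nat by lia. ring.
  - intros i Hi. unfold psi_sq_coef.
    replace (S r + 2 - 1 - i)%nat with (r - i + 2)%nat by lia.
    replace (S r + 1 - 1 - i)%nat with (r - i + 1)%nat by lia.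
    destruct (r - i)%nat eqn:D; [lia|]. ring.
Qed.

Theorem theorem3p3 (q : nat) (hq : (1 < q)%nat) :
  (1 + (-1) ^ (q + 1)) * Tbar q =
    (INR q - 2) * PI * zetabar (q + 1) - 2 * PI * zetabar1 q
    - 4 * PI * ln 2 * zetabar q - 2 * ttildebar1 (q + 1)
    + (-1) ^ q * tbar (q + 2)
    - (1 + (-1) ^ q) * 4 * ln 2 * tbar (q + 1)
    - (1 - (-1) ^ q) * 4 * (ln 2) ^ 2 * tbar q
    - 2 * sum_2k1_k2_k3 (q + 1)
            (fun k1 k2 k3 => tbar (2 * k1 - 1) * zeta (k2 + 1) * zeta (k3 + 1))
    + 4 * sum_2k1_k2 (q + 2)
            (fun k1 k2 => tbar (2 * k1 - 1) * zeta (k2 + 1))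
    + 8 * ln 2 * sum_2k1_k2 (q + 1)
            (fun k1 k2 => tbar (2 * k1 - 1) * zeta (k2 + 1)).
Proof.
  assert (E := is_lim_seq_unique_R _ _ _ (alt_odd_h_lim q hq)
    (alt_odd_psi_sq_lim (2 * ln 2) q hq)).
  rewrite psum_psi_sq_coef in E by lia.
  replace ((-1) ^ (q + 2)) with ((-1) ^ q) in E by (rewrite pow_add; simpl; ring).
  replace ((-1) ^ (q + 1)) with (- (-1) ^ q) in * by (rewrite pow_add; simpl; ring).
  (* Solving for the multiple of [Tbar q] moves [tbar (q + 2)] to the right, where it reduces -(1 -
     (-1)^q) to (-1)^q. *)
  match type of E with ?l + 2 * ?t + -1 * ?u = ?r =>
    replace l with (r - 2 * t + u) by lra end.
  ring.
Qed.
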